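(* Let $n\geqslant 2$ and let $(M^n,g)$ be a compact, connected, oriented $n$-dimensional Riemannian manifold without boundary, isometrically immersed in $\mathbb{R}^{n+1}$. Let $\theta\in\,]0,1[$. If $(M^n,g)$ is almost-umbilical, that is, $\|B-kg\|_\infty\leqslant\varepsilon$ for a positive constant $k$, with $\varepsilon>0$ small enough depending on $n$, $k$ and $\theta$ (that is, there is a constant $\varepsilon>0$ depending on $n$, $k$, $\theta$ such that this inequality implies the following conclusion), then $M$ is diffeomorphic and $\theta$-quasi-isometric to $\mathbb{S}^n\left(\frac1k\right)$.
   Context: Let $\nu$ be a global unit normal vector field along the immersion (a choice of orientation of the normal bundle), and let $\overline{\nabla}$ be the flat connection of $\mathbb{R}^{n+1}$. The second fundamental form is $B(Y,Z)=-g(\overline{\nabla}_Y\nu,Z)$. $\|\cdot\|_\infty$ is the sup norm over $M$ of the pointwise tensor norm induced by $g$. $\mathbb{S}^n(\rho)$ is the round $n$-sphere of radius $\rho$. $M$ is $\theta$-quasi-isometric to $\mathbb{S}^n(\rho)$ if there is a diffeomorphism $F$ from $M$ onto $\mathbb{S}^n(\rho)$ such that $\big||d_xF(u)|^2-1\big|\leqslant\theta$ for all $x\in M$ and all unit vectors $u\in T_xM$. *)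

(* Defs.v *)
From mathcomp Require Import all_boot all_order all_algebra.
From mathcomp Require Import all_classical all_reals all_analysis.

Set Implicit Arguments.
Unset Strict Implicit.
Unset Printing Implicit Defensive.

Import Order.TTheory GRing.Theory Num.Theory.
Import numFieldNormedType.Exports.
Local Open Scope classical_set_scope.
Local Open Scope ring_scope.

(* The library norm on ['rV[R]_m] is the sup norm; it induces the usual       *)
(* topology and derivatives, and lengths are always measured with [enorm].    *)
Definition dotv {R : realType} {m : nat} (u v : 'rV[R]_m) : R :=
  \sum_i u 0 i * v 0 i.

Definition enorm {R : realType} {m : nat} (u : 'rV[R]_m) : R :=
  Num.sqrt (dotv u u).

Definition sphere {R : realType} (n : nat) (rho : R) : set 'rV[R]_n.+1 :=
  [set y | enorm y = rho].

Arguments sphere {R} n rho.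

(* Only meant for an open set [U]. *)
Fixpoint Ck_on {R : realType} {V W : normedModType R} (k : nat) (U : set V)
    (f : V -> W) : Prop :=
  match k with
  | 0%N => forall x, U x -> {for x, continuous f}
  | k'.+1 => (forall x, U x -> differentiable f x) /\
             (forall v, Ck_on k' U (fun x => 'D_v f x))
  end.

Definition smooth_on {R : realType} {V W : normedModType R} (U : set V)
    (f : V -> W) : Prop :=
  forall k, Ck_on k U f.

(* A homeomorphism from the open set [cdom] onto an open set of R^n.  The     *)
(* values of [cmap] and [cinv] outside [cdom] and its image are irrelevant.   *)
Record chart (R : realType) (n : nat) (M : topologicalType) := Chart {
  cdom : set M;
  cmap :> M -> 'rV[R]_n;
  cinv : 'rV[R]_n -> M;
  cdom_open : open cdom;
  ccod_open : open (cmap @` cdom);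
  cmapK : forall p, cdom p -> cinv (cmap p) = p;
  cmap_continuous : forall p, cdom p -> {for p, continuous cmap};
  cinv_continuous : forall y, (cmap @` cdom) y -> {for y, continuous cinv}
}.

(* The atlas need not be maximal.  [chart_at] selects a chart around every    *)
(* point, which serves to represent the tangent space at that point.          *)
Record smoothManifold (R : realType) (n : nat) := SmoothManifold {
  carrier :> topologicalType;
  hausdorff_carrier : hausdorff_space carrier;
  second_countable_carrier : @second_countable carrier;
  atlas : set (chart R n carrier);
  chart_at : carrier -> chart R n carrier;
  chart_at_atlas : forall p, atlas (chart_at p);
  chart_at_dom : forall p, cdom (chart_at p) p;
  atlas_compatible : forall c d, atlas c -> atlas d ->
    smooth_on (c @` (cdom c `&` cdom d)) (d \o cinv c)
}.

Arguments atlas {R n} M : rename.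
Arguments chart_at {R n M} p : rename.

Definition oriented {R : realType} {n : nat} (M : smoothManifold R n) : Prop :=
  forall c d, atlas M c -> atlas M d ->
  forall p, cdom c p -> cdom d p -> 0 < \det (jacobian (d \o cinv c) (c p)).

(* A tangent vector at [p] is given by its components in [chart_at p]. *)
Definition tangent {R : realType} {n : nat} {M : smoothManifold R n} (p : M) :=
  'rV[R]_n.

(* The tangent vector at [p] whose components in the chart [c] are [v]. *)
Definition tangent_of {R : realType} {n : nat} {M : smoothManifold R n}
    (c : chart R n M) (p : M) (v : 'rV[R]_n) : tangent p :=
  'd (chart_at p \o cinv c) (c p) v.

Definition smooth {R : realType} {n : nat} {M : smoothManifold R n}
    {W : normedModType R} (f : M -> W) : Prop :=
  forall c, atlas M c -> smooth_on (c @` cdom c) (f \o cinv c).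

Definition mdiff {R : realType} {n : nat} {M : smoothManifold R n}
    {W : normedModType R} (f : M -> W) (p : M) (u : tangent p) : W :=
  'd (f \o cinv (chart_at p)) (chart_at p p) u.

Arguments mdiff {R n M W} f p u.

(* Smoothness on an open set [U] of a map into a manifold. *)
Definition smooth_into {R : realType} {n : nat} {M : smoothManifold R n}
    {V : normedModType R} (U : set V) (f : V -> M) : Prop :=
  (forall y, U y -> {for y, continuous f}) /\
  (forall c, atlas M c -> smooth_on (U `&` f @^-1` cdom c) (c \o f)).

(* [S] is meant to be a submanifold of R^m.  Smoothness of the inverse means, *)
(* as usual for maps defined on a subset of R^m, that it extends smoothly     *)
(* to a neighbourhood in R^m of each point of [S].                            *)
Definition diffeomorphism_onto {R : realType} {n m : nat}
    {M : smoothManifold R n} (S : set 'rV[R]_m) (F : M -> 'rV[R]_m) : Prop :=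
  [/\ smooth F,
      set_bij [set: M] S F &
      forall y, S y -> exists (U : set 'rV[R]_m) (G : 'rV[R]_m -> M),
        [/\ open U, U y, smooth_into U G &
            forall p, U (F p) -> G (F p) = p]].

Definition diffeomorphic_to {R : realType} {n m : nat}
    (M : smoothManifold R n) (S : set 'rV[R]_m) : Prop :=
  exists F : M -> 'rV[R]_m, diffeomorphism_onto S F.

Record riemannianMetric {R : realType} {n : nat} (M : smoothManifold R n) :=
  RiemannianMetric {
  metric :> forall p : M, tangent p -> tangent p -> R;
  metric_linear : forall p a (u v w : tangent p),
    metric (a *: u + v) w = a * metric u w + metric v w;
  metric_sym : forall p (u v : tangent p), metric u v = metric v u;
  metric_pos : forall p (u : tangent p), u != 0 -> 0 < metric u u;
  metric_smooth : forall c, atlas M c -> forall u v : 'rV[R]_n,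
    smooth_on (c @` cdom c)
      (fun y => metric (tangent_of c (cinv c y) u)
                       (tangent_of c (cinv c y) v) : R^o)
}.

Arguments metric {R n M} g p u v : rename.

Definition tensor2 {R : realType} {n : nat} (M : smoothManifold R n) :=
  forall p : M, tangent p -> tangent p -> R.

Definition components {R : realType} {n : nat} {M : smoothManifold R n}
    (T : tensor2 M) (p : M) : 'M[R]_n :=
  \matrix_(i, j) T p (delta_mx 0 i) (delta_mx 0 j).

(* |T|^2 = g^{ia} g^{jb} T_{ij} T_{ab}, i.e. the sum of the T(e_i, e_j)^2     *)
(* over a g-orthonormal basis (e_i) of the tangent space at [p].              *)
Definition tensor_norm {R : realType} {n : nat} {M : smoothManifold R n}
    (g : riemannianMetric M) (T : tensor2 M) (p : M) : R :=
  let G := invmx (components (metric g) p) in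
  let A := components T p in
  Num.sqrt (\tr (G *m A *m G *m A^T)).

Definition sup_norm {R : realType} {n : nat} {M : smoothManifold R n}
    (g : riemannianMetric M) (T : tensor2 M) : \bar R :=
  ereal_sup [set (tensor_norm g T p)%:E | p in [set: M]].

Definition isometric_immersion {R : realType} {n m : nat}
    {M : smoothManifold R n} (g : riemannianMetric M) (phi : M -> 'rV[R]_m)
    : Prop :=
  [/\ smooth phi,
      forall p : M, injective (mdiff phi p) &
      forall (p : M) (u v : tangent p),
        dotv (mdiff phi p u) (mdiff phi p v) = g p u v].

Definition unit_normal {R : realType} {n m : nat} {M : smoothManifold R n}
    (phi nu : M -> 'rV[R]_m) : Prop :=
  [/\ smooth nu,
      forall p : M, enorm (nu p) = 1 &
      forall (p : M) (u : tangent p), dotv (nu p) (mdiff phi p u) = 0].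

(* The flat derivative of [nu] along [u] is the differential of [nu], seen as *)
(* a vector-valued function, and [v] is identified with its image under the   *)
(* differential of the immersion.                                             *)
Definition second_fundamental_form {R : realType} {n m : nat}
    {M : smoothManifold R n} (phi nu : M -> 'rV[R]_m) : tensor2 M :=
  fun p u v => - dotv (mdiff nu p u) (mdiff phi p v).

Arguments second_fundamental_form {R n m M} phi nu p u v.

Definition quasi_isometric_to {R : realType} {n m : nat}
    (M : smoothManifold R n) (g : riemannianMetric M) (theta : R)
    (S : set 'rV[R]_m) : Prop :=
  exists F : M -> 'rV[R]_m, diffeomorphism_onto S F /\
    forall (p : M) (u : tangent p), g p u u = 1 ->
      `|enorm (mdiff F p u) ^+ 2 - 1| <= theta.

(* Main.v *)
(* The Gauss map [nu / k] is the required quasi-isometry.  The tangent part of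
   [d nu + k d phi] is [-(B - k g)], so [|d nu u + k d phi u| <= eps |u|] and
   [d (nu / k)] is [3 eps / k]-close to an isometry; in particular [nu / k] is a
   local diffeomorphism onto the sphere.  It is bijective because [M] is compact
   and [n >= 2]: both inverse stereographic projections lift to [M] along
   straight rays, the two lifts agree on the connected overlap R^n \ {0}, and
   the union of their images is open and compact, hence all of [M]. *)
Require Import Defs.
From HB Require Import structures.
From mathcomp Require Import all_boot all_order all_algebra.
From mathcomp Require Import all_classical all_reals all_analysis.
From mathcomp Require Import ring lra.
Import Order.TTheory GRing.Theory Num.Theory.
Import numFieldNormedType.Exports.
Local Open Scope classical_set_scope.
Local Open Scope ring_scope.

Set Implicit Arguments.
Unset Strict Implicit.
Unset Printing Implicit Defensive.

(** * Lifting along local homeomorphisms *)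

(** A curvature bound yields only a local diffeomorphism, so the obstacle is the number of sheets of
    the Gauss map. For [n = 1], a circle traversed twice has [B = k g] and a two-to-one Gauss map;
    for [n >= 2], any two points of R^n minus 0 are joined by segments avoiding 0, which forces the
    two lifts to agree. A ray lifts up to its end because [M] is compact: around each point of R^n
    some radius serves for lifts through all points of [M] above at once. The union of the two
    images is compact because inversion exchanges the outside of the unit ball in one chart with the
    inside in the other. The sphere is not open in R^(n+1), so local sections and smooth inverses
    live on ambient open sets; a radial variable is added before inverting. The constant is
    [eps = k theta / 3]. With [|u| = 1] and [w = d nu u + k d phi u], one has
    [d (nu / k) u = w / k - d phi u], hence [|d (nu / k) u|^2 - 1 = |w|^2 / k^2 - 2 <w, d phi u> /
    k], bounded by [theta^2 / 9 + 2 theta / 3 < theta]. *)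

Lemma continuous_at_eq_on {T U : topologicalType} (A : set T) (f g : T -> U) (x : T) :
  open A -> A x -> (forall y, A y -> f y = g y) ->
  {for x, continuous f} -> {for x, continuous g}.
Proof.
move=> oA Ax fg cf; have nA : nbhs x A by exact: open_nbhs_nbhs.
move=> B; rewrite -(fg _ Ax) => /cf; rewrite !nbhs_simpl /=.
by apply: filterS2 nA => y Ay; rewrite /= fg.
Qed.

Definition locally_injective {T U : topologicalType} (F : T -> U) :=
  forall p : T, exists2 N : set T, nbhs p N &
    forall q q', N q -> N q' -> F q = F q' -> q = q'.

(** For a map into [S] this is a local homeomorphism onto [S]. The section [s] is a total function,
    continuous on an open set of the ambient space, and inverts [F] only at points of [S], so the
    subspace topology of [S] never appears. *)
Definition has_local_sections {T U : topologicalType} (S : set U) (F : T -> U) :=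
  forall p : T, exists (W : set U) (s : U -> T), [/\ open W /\ W (F p),
    forall y, W y -> {for y, continuous s},
    forall y, W y -> S y -> F (s y) = y &
    \forall q \near p, s (F q) = q].

Lemma local_sections_injective {T U : topologicalType} (S : set U) (F : T -> U) :
  has_local_sections S F -> locally_injective F.
Proof.
move=> sF p; have [W [s [_ _ _ sFp]]] := sF p.
by exists [set q | s (F q) = q] => // q q' /= sq sq' Fq; rewrite -[q]sq Fq.
Qed.

(** The agreement set is open because [F] is injective near a common value, and closed because [M]
    is Hausdorff; [x0] makes it nonempty. *)
Lemma lifts_agree {X M Y : topologicalType} (F : M -> Y) (g1 g2 : X -> M) x0 :
  hausdorff_space M -> locally_injective F -> connected [set: X] ->
  continuous g1 -> continuous g2 -> F \o g1 =1 F \o g2 -> g1 x0 = g2 x0 ->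
  g1 =1 g2.
Proof.
move=> hM liF cX cg1 cg2 Fg g0 x.
suff E : [set z | g1 z = g2 z] = [set: X].
  by have : [set: X] x by []; rewrite -E.
apply: cX; first by exists x0.
- exists [set z | g1 z = g2 z]; last by rewrite setTI.
  rewrite openE => z /= gz; rewrite /interior.
  have [N Np Ninj] := liF (g1 z).
  have N2 : nbhs (g2 z) N by rewrite -gz.
  have := cg1 z N Np; have := cg2 z N N2; rewrite !nbhs_simpl /= => h2 h1.
  near=> w; apply: Ninj; [near: w; exact: h1|near: w; exact: h2|exact: Fg].
- exists [set z | g1 z = g2 z]; last by rewrite setTI.
  rewrite -openC openE => z /= /eqP gz; rewrite /interior.
  move: hM; rewrite open_hausdorff => /(_ _ _ gz)[[A B] /= [zA zB] [oA oB AB0]].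
  move: zA zB; rewrite !inE => zA zB.
  have h1 := cg1 z A (open_nbhs_nbhs (conj oA zA)).
  have h2 := cg2 z B (open_nbhs_nbhs (conj oB zB)).
  rewrite !nbhs_simpl /= in h1 h2.
  near=> w.
  have Aw : A (g1 w) by near: w; exact: h1.
  have Bw : B (g2 w) by near: w; exact: h2.
  move=> /= gw; move/eqP: AB0; rewrite -subset0 => /(_ (g1 w)); apply.
  by split=> //; rewrite gw.
Unshelve. all: by end_near. Qed.

Section Lifting.
Context {R : realType} {V : normedModType R}.

(** Retraction of the line onto [0, 1]: it extends a segment to a path defined on all of [R], so
    that [lifts_agree], which is about whole spaces, applies to lifts that are continuous only along
    a segment. *)
Let clamp (t : R) : R := Num.max 0 (Num.min 1 t).

Let clamp_continuous : continuous clamp.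
Proof.
move=> t.
have c1 : {for t, continuous ((fun=> 1) : R -> R)} by exact: cst_continuous.
have c0 : {for t, continuous ((fun=> 0) : R -> R)} by exact: cst_continuous.
exact: continuous_max c0 (continuous_min c1 (@cvg_id _ _)).
Qed.

Let clamp_itv t : 0 <= clamp t <= 1.
Proof. by rewrite /clamp le_max lexx /= ge_max ge_min lexx ler01. Qed.

Lemma lifts_agree_segment {M Y : topologicalType} (F : M -> Y) (g1 g2 : V -> M)
    (x y : V) :
  hausdorff_space M -> locally_injective F ->
  (forall t, 0 <= t <= 1 -> let z := x + t *: (y - x) in
    [/\ {for z, continuous g1}, {for z, continuous g2} & F (g1 z) = F (g2 z)]) ->
  g1 x = g2 x -> g1 y = g2 y.
Proof.
move=> hM liF H gx.
pose c (t : R) : V := x + clamp t *: (y - x).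
have cc : continuous c.
  move=> t; apply: cvgD; first exact: cvg_cst.
  by apply: cvgZr_tmp; exact: clamp_continuous.
have c0 : c 0 = x by rewrite /c /clamp min_r ?ler01// maxxx scale0r addr0.
have c1 : c 1 = y by rewrite /c /clamp minxx max_r// scale1r addrC subrK.
have := @lifts_agree R M Y F (g1 \o c) (g2 \o c) 0 hM liF.
rewrite -c1; move=> /(_ _ _ _ _ _ 1); apply.
- by apply/connected_intervalP => ? ?.
- by move=> t; apply: continuous_comp; [exact: cc|have [] := H _ (clamp_itv t)].
- by move=> t; apply: continuous_comp; [exact: cc|have [] := H _ (clamp_itv t)].
- by move=> t /=; have [] := H _ (clamp_itv t).
- by rewrite /= c0.
Qed.

Context {M Y : topologicalType} (S : set Y) (F : M -> Y).
Hypotheses (hM : hausdorff_space M) (hY : hausdorff_space Y)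
  (cM : compact [set: M]) (cF : continuous F) (sF : has_local_sections S F).

Let liF : locally_injective F := local_sections_injective sF.

(** Compactness makes the radius independent of [p]. Near a point above [c z], a local section
    composed with [c] is the lift. Near any other point, [F q] and [c w] stay in disjoint open sets,
    so the requirement is void. *)
Lemma uniform_local_lifts (c : V -> Y) (z : V) :
  continuous c -> (forall x, S (c x)) ->
  exists2 r : R, 0 < r & forall p w, `|z - w| <= r -> F p = c w ->
    exists2 s : V -> M, s w = p &
      forall x, `|z - x| <= r -> {for x, continuous s} /\ F (s x) = c x.
Proof.
move=> cc Sc.
pose P (r : R) p := forall w, `|z - w| <= r -> F p = c w ->
    exists2 s : V -> M, s w = p &
      forall x, `|z - x| <= r -> {for x, continuous s} /\ F (s x) = c x.
have F0 : ProperFilter (0^'+ : set_system R) by exact: at_right_proper_filter.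
suff : \forall r \near 0^'+, [set: M] `<=` P r.
  move=> H; near (0^'+ : set_system R) => r.
  have HP : [set: M] `<=` P r by near: r; exact: H.
  by exists r; [near: r; exact: nbhs_right_gt|move=> p; exact: HP].
apply: ((compact_near_coveringP [set: M]).1 cM R (0^'+) P _ _) => p _.
have [Fp|/eqP Fp] := pselect (F p = c z).
  have [W [s [[oW Wp] cs sW nears]]] := sF p.
  have cW : \forall x \near z, W (c x).
    by apply: cc; apply: open_nbhs_nbhs; split=> //; rewrite -Fp.
  exists ([set q | s (F q) = q], [set r | forall y, `|z - y| <= r -> W (c y)]).
    by split => //=; move/nbhsr0P: cW.
  move=> [q r] /= [sq Wr] w zw Fq; exists (s \o c); first by rewrite /= -Fq.
  move=> x zx; split; last by apply: sW => //; exact: Wr.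
  by apply: continuous_comp; [exact: cc|apply: cs; exact: Wr].
move: hY; rewrite open_hausdorff => /(_ _ _ Fp)[[A B] /= [zA zB] [oA oB AB0]].
move: zA zB; rewrite !inE => zA zB.
have cB : \forall x \near z, B (c x) by apply: cc; exact: open_nbhs_nbhs.
exists ([set q | A (F q)], [set r | forall y, `|z - y| <= r -> B (c y)]).
  by split; [apply: cF; exact: open_nbhs_nbhs|move/nbhsr0P: cB].
move=> [q r] /= [Aq Br] w zw Fq; move/eqP: AB0; rewrite -subset0.
by move=> /(_ (F q)) []; split=> //; rewrite Fq; exact: Br.
Unshelve. all: by end_near. Qed.

End Lifting.

(** * Lifting a map from a normed space along rays *)

Section MaximalLift.
Context {R : realType} {V : normedModType R} {M Y : topologicalType}.
Variables (S : set Y) (F : M -> Y).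
Hypotheses (hM : hausdorff_space M) (hY : hausdorff_space Y)
  (cM : compact [set: M]) (cF : continuous F) (sF : has_local_sections S F).

Let liF : locally_injective F := local_sections_injective sF.

Lemma segment_in_ball (z u v : V) (r t : R) : `|z - u| <= r -> `|z - v| <= r ->
  0 <= t <= 1 -> `|z - (u + t *: (v - u))| <= r.
Proof.
move=> zu zv /andP[t0 t1].
have -> : z - (u + t *: (v - u)) = (1 - t) *: (z - u) + t *: (z - v).
  rewrite scalerBl scale1r -addrA [- (t *: _) + _]addrC -scalerBr.
  by rewrite opprD addrA -scalerN opprB [- (z - u)]opprB [z - v + _]addrC addrA subrK.
apply: le_trans (ler_normD _ _) _; rewrite !normrZ !ger0_norm ?subr_ge0//.
have -> : r = (1 - t) * r + t * r by ring.
by rewrite lerD// ler_wpM2l// subr_ge0.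
Qed.

(** The segment from 0 to a point of [A] stays in [A], so two such lifts agree wherever both are
    defined and can be glued. *)
Record star_lift (c : V -> Y) (p : M) (A : set V) (G : V -> M) : Prop := StarLift {
  star_open : open A;
  star_shaped : forall x (t : R), A x -> 0 <= t <= 1 -> A (t *: x);
  star_continuous : forall x, A x -> {for x, continuous G};
  star_section : forall x, A x -> F (G x) = c x;
  star_base : A 0 /\ G 0 = p }.

Variables (c : V -> Y) (p : M).
Hypotheses (cc : continuous c) (Sc : forall x, S (c x)) (Fp : F p = c 0).

Lemma star_lift_agree A G B H x : star_lift c p A G -> star_lift c p B H ->
  A x -> B x -> G x = H x.
Proof.
move=> [oA sA cG FG [A0 G0]] [oB sB cH FH [B0 H0]] Ax Bx.
apply: (@lifts_agree_segment R V M Y F G H 0 x hM liF); last by rewrite G0.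
move=> t t01; rewrite /= add0r subr0.
by split; [apply: cG; exact: sA|apply: cH; exact: sB|rewrite FG ?FH//; [exact: sB|exact: sA]].
Qed.

Lemma star_lift_exists : exists A G, star_lift c p A G.
Proof.
have [r r0 Hr] := uniform_local_lifts hY cM cF sF 0 cc Sc.
have [|s sp Hs] := Hr p 0 _ Fp; first by rewrite subrr normr0 ltW.
have bl x : ball (0 : V) r x -> `|0 - x| <= r by rewrite -ball_normE => /ltW.
exists (ball 0 r), s; split.
- exact: ball_open.
- move=> x t; rewrite -!ball_normE /= !sub0r !normrN normrZ => xr /andP[t0 t1].
  by rewrite ger0_norm//; apply: le_lt_trans xr; rewrite ler_piMl.
- by move=> x /bl/Hs[].
- by move=> x /bl/Hs[].
- by split=> //; exact: ballxx.
Qed.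

Let D := [set x | exists A G, star_lift c p A G /\ A x].

(** The values are chosen point by point; by [star_lift_agree] they do not depend on the choice, so
    [G] coincides with a genuine star lift on each domain. This is the largest star lift. *)
Lemma star_lift_union : exists G, star_lift c p D G.
Proof.
have /choice[G HG] : forall x, exists q : M, D x ->
    exists A G, [/\ star_lift c p A G, A x & G x = q].
  move=> x; have [[A [G [AG Ax]]]|nD] := pselect (D x); last by exists p.
  by exists (G x) => _; exists A, G.
have GE A H x : star_lift c p A H -> A x -> G x = H x.
  move=> AH Ax; have [|B [K [BK Bx <-]]] := HG x; first by exists A, H.
  exact: star_lift_agree BK AH _ _.
exists G; split.
- rewrite openE => x [A [H [AH Ax]]].
  have := open_nbhs_nbhs (conj (star_open AH) Ax).
  by apply: filterS => y Ay; exists A, H.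
- by move=> x t [A [H [AH Ax]]] t01; exists A, H; split=> //; exact: star_shaped AH _ _ Ax t01.
- move=> x [A [H [AH Ax]]].
  apply: (continuous_at_eq_on (star_open AH) Ax) (star_continuous AH Ax) => y Ay.
  by rewrite (GE _ _ _ AH Ay).
- by move=> x [A [H [AH Ax]]]; rewrite (GE _ _ _ AH Ax); exact: star_section AH _ Ax.
- have [A [H AH]] := star_lift_exists; have [A0 H0] := star_base AH.
  by split; [exists A, H|rewrite (GE _ _ _ AH A0)].
Qed.

(* If [D] missed a point of a ray, let [z] be the first one: a local lift [s]
   around [z] extends [G] to [D `|` C], where [C] is the set of points near [z]
   whose segment towards the origin soon meets a small ball inside [D]. *)
Lemma star_lift_total : D = [set: V].
Proof.
have [G DG] := star_lift_union.
have [oD sD cG FG [D0 G0]] := DG.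
apply/seteqP; split=> // x _; apply: contrapT => nDx.
pose E : set R := [set t | 0 <= t <= 1 /\ D (t *: x)].
have E0 : E 0 by split; [rewrite lexx ler01|rewrite scale0r].
have hsE : has_sup E.
  split; first by exists 0.
  by exists 1 => t [/andP[]].
set T := sup E; have T0 : 0 <= T by apply: sup_upper_bound.
have T1 : T <= 1 by apply: ge_sup; [exists 0|move=> t [/andP[]]].
set z := T *: x.
have nDz : ~ D z.
  move=> Dz; have T1' : T < 1.
    by rewrite lt_neqAle T1 andbT; apply/eqP => Te; apply: nDx; rewrite -[x]scale1r -Te.
  have cD : \forall t \near T, D (t *: x).
    have ct : {for T, continuous (fun t : R => t *: x)} by apply: cvgZr_tmp; exact: cvg_id.
    by apply: ct; apply: open_nbhs_nbhs.
  have : \forall t \near T^'+, D (t *: x) by exact: cvg_within.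
  move=> cD'; have F0 : ProperFilter (T^'+ : set_system R) by exact: at_right_proper_filter.
  near (T^'+ : set_system R) => t.
  have tT : T < t by near: t; exact: nbhs_right_gt.
  have t1 : t < 1 by near: t; exact: nbhs_right_lt.
  have Dt : D (t *: x) by near: t.
  have : t <= T by apply: sup_upper_bound => //; split=> //; rewrite !ltW// (le_lt_trans T0).
  by rewrite leNgt tT.
have Tgt0 : 0 < T.
  rewrite lt_neqAle T0 andbT; apply/eqP => Te; apply: nDz.
  by rewrite /z -Te scale0r.
have [r r0 Hr] := uniform_local_lifts hY cM cF sF z cc Sc.
(* The first bound brings [t *: x] within [r] of [z] (the added 1 covers a zero norm of [x]); the
   second keeps [t] positive. *)
pose e := Num.min (r / (`|x| + 1)) T.
have x1 : 0 < `|x| + 1 by rewrite ltr_wpDl.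
have e0 : 0 < e by rewrite lt_min divr_gt0.
have [t [/andP[t0 t1] Dt] te] := sup_adherent e0 hsE.
have {}t0 : 0 < t by apply: le_lt_trans te; rewrite subr_ge0 ge_min lexx orbT.
have tT : t <= T by apply: sup_upper_bound => //; split=> //; rewrite ltW.
have zt : `|z - t *: x| < r.
  rewrite /z -scalerBl normrZ ger0_norm ?subr_ge0//.
  have : (T - t) * (`|x| + 1) < r.
    rewrite -ltr_pdivlMr// ltrBlDl -ltrBlDr; apply: le_lt_trans te.
    by rewrite lerB// ge_min lexx.
  apply: le_lt_trans; rewrite ler_wpM2l ?subr_ge0// lerDl ler01 //.
have [|s st Hs] := Hr (G (t *: x)) (t *: x) (ltW zt); first exact: FG.
have [eta /= eta0 Heta] : exists2 eta : R, 0 < eta & forall y, `|t *: x - y| < eta ->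
    D y /\ `|z - y| < r.
  have n1 : nbhs (t *: x) D by exact: open_nbhs_nbhs.
  have n2 : nbhs (t *: x) (ball z r).
    by apply: open_nbhs_nbhs; split; [exact: ball_open|rewrite -ball_normE].
  have /nbhs_ballP[eta eta0 H] : nbhs (t *: x) (D `&` ball z r) by exact: filterI.
  exists eta => // y ty; have [] := H y; first by rewrite -ball_normE.
  by rewrite -ball_normE.
pose C := [set w | `|z - w| < r /\ exists2 a : R, 0 < a <= 1 & `|t *: x - a *: w| < eta].
have oC : open C.
  rewrite openE => w [zw [a a01 aw]].
  have n1 : \forall v \near w, `|z - v| < r.
    rewrite -[\forall v \near w, _]/(nbhs w _).
    have : nbhs w (ball z r) by apply: open_nbhs_nbhs; split; [exact: ball_open|rewrite -ball_normE].
    by rewrite -ball_normE.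
  have n2 : \forall v \near w, `|t *: x - a *: v| < eta.
    have ca : {for w, continuous (fun v => a *: v)} by apply: cvgZl_tmp; exact: cvg_id.
    have : nbhs (a *: w) (ball (t *: x) eta).
      by apply: open_nbhs_nbhs; split; [exact: ball_open|rewrite -ball_normE].
    by move=> /ca; rewrite -ball_normE.
  by apply: filterS2 n1 n2 => v v1 v2; split=> //; exists a.
(* Two segments carry the agreement: from [t *: x] to [a *: w] inside the [eta]-ball, then from
   [a *: w] to [w], which stays in [D] by star shape and in the [r]-ball by convexity. *)
have agree w : C w -> D w -> G w = s w.
  move=> [zw [a /andP[a0 a1] aw]] Dw.
  have Gs : G (a *: w) = s (a *: w).
    apply: (@lifts_agree_segment R V M Y F G s (t *: x) (a *: w) hM liF) => // u u01 y.
    have /Heta[Dy zy] : `|t *: x - y| < eta.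
      rewrite /y opprD addNKr normrN normrZ ger0_norm ?(andP u01).1//.
      rewrite distrC; apply: le_lt_trans aw; rewrite ler_piMl// (andP u01).2//.
    have [cs Fs] := Hs _ (ltW zy).
    by split; [exact: cG| |rewrite FG// Fs].
  apply: (@lifts_agree_segment R V M Y F G s (a *: w) w hM liF) => // u u01 y.
  have Dy : D y.
    have -> : y = (a + u * (1 - a)) *: w.
      by rewrite /y scalerDl -scalerA scalerBl scale1r.
    by apply: sD => //; case/andP: u01 => u0 u1; apply/andP; split; nra.
  have [_ zaw] := Heta _ aw.
  have [cs Fs] := Hs y (segment_in_ball (ltW zaw) (ltW zw) u01).
  by split; [exact: cG| |rewrite FG// Fs].
pose G' w := if `[< D w >] then G w else s w.
have GD w : D w -> G' w = G w by move=> Dw; rewrite /G' asboolT.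
have GC w : C w -> G' w = s w.
  by move=> Cw; rewrite /G'; case: asboolP => // Dw; exact: agree.
(* The witness [a = t / T] gives [a *: z = t *: x]. *)
have Cz : C z.
  split; first by rewrite subrr normr0.
  exists (t / T).
    by rewrite ler_pdivrMr// mul1r tT andbT divr_gt0.
  by rewrite /z scalerA divfK ?gt_eqF// subrr normr0.
apply: nDz; exists (D `|` C), G'; split; last by right.
split.
- exact: openU.
(* For [u <= a] the point [u *: w] lies between 0 and [a *: w], hence in [D]. For [u > a] it lies
   between [a *: w] and [w], hence near [z], and [a / u] witnesses membership in [C]. *)
- move=> w u [Dw|[zw [a /andP[a0 a1] aw]]] u01; first by left; exact: sD.
  have [Daw zaw] := Heta _ aw.
  have [ua|au] := leP u a.
    left; have -> : u *: w = (u / a) *: (a *: w) by rewrite scalerA divfK ?gt_eqF.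
    apply: sD => //; rewrite ler_pdivrMr// mul1r ua andbT divr_ge0 ?(ltW a0)//.
    by case/andP: u01.
  have u0 : 0 < u by exact: lt_trans au.
  right; split; last first.
    exists (a / u); last by rewrite scalerA divfK ?gt_eqF.
    by rewrite divr_gt0//= ler_pdivrMr// mul1r ltW.
  have u1 : u <= 1 by case/andP: u01.
  have a1' : 0 < 1 - a by rewrite subr_gt0; exact: lt_le_trans u1.
  have -> : u *: w = a *: w + ((u - a) / (1 - a)) *: (w - a *: w).
    rewrite -[X in _ *: (X - _)]scale1r -scalerBl scalerA divfK ?gt_eqF//.
    by rewrite -scalerDl addrC subrK.
  have mr : Num.max `|z - a *: w| `|z - w| < r by rewrite gt_max zaw zw.
  apply: le_lt_trans mr; apply: segment_in_ball; rewrite ?le_max ?lexx ?orbT//.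
  rewrite divr_ge0 ?subr_ge0 ?(ltW au)// ?(le_trans (ltW au))//=.
  by rewrite ler_pdivrMr// mul1r lerB.
- move=> w [Dw|Cw].
    by apply: (continuous_at_eq_on oD Dw) (cG _ Dw) => y Dy; rewrite GD.
  have [cs _] := Hs _ (ltW Cw.1).
  by apply: (continuous_at_eq_on oC Cw) cs => y Cy; rewrite GC.
- move=> w [Dw|Cw]; first by rewrite GD// FG.
  by rewrite GC//; have [] := Hs _ (ltW Cw.1).
- by split; [left|rewrite GD].
Unshelve. all: by end_near. Qed.

Lemma lift_exists : exists2 G : V -> M, continuous G & F \o G =1 c /\ G 0 = p.
Proof.
have [G] := star_lift_union; rewrite star_lift_total => -[_ _ cG FG [_ G0]].
by exists G => [x|]; [exact: cG|split=> // x; exact: FG].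
Qed.

End MaximalLift.
(** * Maps onto the sphere that are local homeomorphisms *)

Section DotProduct.
Context {R : realType} {n : nat}.
Implicit Types u v w : 'rV[R]_n.

Lemma dotvC u v : dotv u v = dotv v u.
Proof. by apply: eq_bigr => i _; rewrite mulrC. Qed.

Lemma dotvDl u v w : dotv (u + v) w = dotv u w + dotv v w.
Proof. by rewrite -big_split; apply: eq_bigr => i _; rewrite mxE mulrDl. Qed.

Lemma dotvZl a u v : dotv (a *: u) v = a * dotv u v.
Proof. by rewrite mulr_sumr; apply: eq_bigr => i _; rewrite mxE mulrA. Qed.

Lemma dotvDr u v w : dotv u (v + w) = dotv u v + dotv u w.
Proof. by rewrite dotvC dotvDl !(dotvC u). Qed.

Lemma dotvZr a u v : dotv u (a *: v) = a * dotv u v.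
Proof. by rewrite dotvC dotvZl dotvC. Qed.

Lemma dotv_ge0 u : 0 <= dotv u u.
Proof. by apply: sumr_ge0 => i _; rewrite -expr2 sqr_ge0. Qed.

Lemma dotv0l u : dotv 0 u = 0.
Proof. by rewrite -[0](scale0r u) dotvZl mul0r. Qed.

Lemma dotv_eq0 u : (dotv u u == 0) = (u == 0).
Proof.
apply/idP/eqP => [|->]; last by rewrite dotv0l.
rewrite psumr_eq0 => [/allP u0|i _]; last by rewrite -expr2 sqr_ge0.
apply/rowP => i; rewrite mxE; apply/eqP.
by have := u0 i (mem_index_enum i); rewrite /= mulf_eq0 orbb.
Qed.

Lemma dotv_gt0 u : (0 < dotv u u) = (u != 0).
Proof. by rewrite lt_def dotv_ge0 andbT dotv_eq0. Qed.

Lemma coord_sqr_le_dotv u i : u 0 i ^+ 2 <= dotv u u.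
Proof.
rewrite /dotv (bigD1 i)//= expr2 lerDl.
by apply: sumr_ge0 => j _; rewrite -expr2 sqr_ge0.
Qed.

Lemma enorm_sqr u : enorm u ^+ 2 = dotv u u.
Proof. by rewrite sqr_sqrtr// dotv_ge0. Qed.

Lemma dotvv_continuous : continuous (fun u => dotv u u).
Proof.
apply: continuous_big => [|i _] /=; first by move=> x; apply: cvgD; [exact: cvg_fst|exact: cvg_snd].
by move=> v; apply: continuousM; exact: coord_continuous.
Qed.

(** Transition map between the stereographic charts from opposite poles. Since [0^-1 = 0], it sends
    0 to 0 and is an involution of the whole space. *)
Definition inversion u := (dotv u u)^-1 *: u.

Lemma dotv_inversion u : dotv (inversion u) (inversion u) = (dotv u u)^-1.
Proof.
rewrite /inversion dotvZl dotvZr.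
have [->|u0] := eqVneq u 0; first by rewrite dotv0l invr0 !mul0r.
by rewrite mulVf ?mulr1// dotv_eq0.
Qed.

Lemma inversionK : involutive inversion.
Proof.
move=> u; rewrite {1}/inversion dotv_inversion invrK /inversion scalerA.
have [->|u0] := eqVneq u 0; first by rewrite scaler0.
by rewrite mulfV ?scale1r// dotv_eq0.
Qed.

Lemma inversion_eq0 u : (inversion u == 0) = (u == 0).
Proof.
by rewrite -!dotv_eq0 dotv_inversion invr_eq0.
Qed.

Lemma inversion_continuous u : u != 0 -> {for u, continuous inversion}.
Proof.
move=> u0.
have cv : (dotv v v)^-1 @[v --> u] --> (dotv u u)^-1.
  by apply: (@cvgV _ _ (nbhs u) _ (fun v => dotv v v) (dotv u u)); [rewrite dotv_eq0|exact: dotvv_continuous].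
exact: cvgZ cv cvg_id.
Qed.

Lemma unit_ball_compact : compact [set u : 'rV[R]_n | dotv u u <= 1].
Proof.
apply: bounded_closed_compact.
  exists 1; split => // a a1 u /= u1; rewrite /Num.Def.normr /= mx_normrE.
  apply: bigmax_le => [|[i j] _]; first exact: le_trans (ltW a1).
  rewrite /= ord1; apply: le_trans (ltW a1).
  rewrite -(@ler_pXn2r _ 2)// ?nnegrE// expr1n real_normK ?num_real//.
  exact: le_trans (coord_sqr_le_dotv _ _) u1.
have -> : [set u : 'rV[R]_n | dotv u u <= 1] = (fun u : 'rV[R]_n => dotv u u) @^-1` [set x | x <= 1] by [].
by apply: preimage_closed => [u _|]; [exact: dotvv_continuous|exact: closed_le].
Qed.

(** If a coordinate [l] is nonzero in both vectors, take [w] to be another basis vector [e_m]: on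
    each line coordinate [l] vanishes only at [e_m] itself. Otherwise the vectors have nonzero
    coordinates at two places where the other one vanishes, and the direct line avoids 0. *)
Lemma nonzero_detour (u v : 'rV[R]_n) : (2 <= n)%N -> u != 0 -> v != 0 ->
  exists w, (forall t : R, u + t *: (w - u) != 0) /\
            (forall t : R, w + t *: (v - w) != 0).
Proof.
move=> n2 /rV0Pn[i ui] /rV0Pn[j vj].
have coordE (x y : 'rV[R]_n) (t : R) l :
    (x + t *: (y - x)) 0 l = (1 - t) * x 0 l + t * y 0 l.
  by rewrite !mxE; ring.
have [ij|[l [ul vl]]] : (u 0 j == 0 /\ v 0 i == 0) \/
    exists l, u 0 l != 0 /\ v 0 l != 0.
- have [uj|uj] := boolP (u 0 j == 0); last by right; exists j.
  have [vi|vi] := boolP (v 0 i == 0); last by right; exists i.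
  by left.
- case: ij => /eqP uj /eqP vi; exists v; split => t; last first.
    by rewrite subrr scaler0 addr0; apply/rV0Pn; exists j.
  apply/rV0Pn; have [->|t0] := eqVneq t 0.
    by exists i; rewrite scale0r addr0.
  by exists j; rewrite coordE uj mulr0 add0r mulf_neq0.
(* [2 <= n] is [1 < n] by definition, so [Ordinal n2] is the index 1 and [Ordinal (ltnW n2)] the
   index 0. *)
- have [m ml] : exists m : 'I_n, m != l.
    have [l0|l0] := eqVneq (l : nat) 0%N.
      by exists (Ordinal n2); rewrite -val_eqE /= l0.
    by exists (Ordinal (ltnW n2)); rewrite -val_eqE /= eq_sym.
  exists (delta_mx 0 m).
  have dl : (delta_mx 0 m : 'rV[R]_n) 0 l = 0 by rewrite mxE eqxx eq_sym (negbTE ml).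
  have dm : (delta_mx 0 m : 'rV[R]_n) 0 m = 1 by rewrite mxE !eqxx.
  split => t; apply/rV0Pn.
    have [->|t1] := eqVneq t 1; last first.
      by exists l; rewrite coordE dl mulr0 addr0 mulf_neq0// subr_eq0 eq_sym.
    by exists m; rewrite coordE dm subrr mul0r add0r mulr1 oner_neq0.
  have [->|t0] := eqVneq t 0; last by exists l; rewrite coordE dl mulr0 add0r mulf_neq0.
  by exists m; rewrite coordE dm mul0r addr0 subr0 mulr1 oner_neq0.
Qed.

End DotProduct.
Lemma linear_rV_continuous {R : realType} {m : nat} {W : normedModType R}
  (f : {linear 'rV[R]_m -> W}) : continuous f.
Proof.
have fE : f = (fun u => \sum_(i < m) u 0 i *: f (delta_mx 0 i)) :> ('rV[R]_m -> W).
  apply/funext => u; rewrite [in LHS](row_sum_delta u) linear_sum.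
  by apply: eq_bigr => i _; rewrite linearZ.
rewrite fE; apply: continuous_big => [u|i _ u].
  by apply: cvgD; [exact: cvg_fst|exact: cvg_snd].
by apply: (@cvgZr_tmp _ _ _ (nbhs u) _ (fun v : 'rV_m => v 0 i) (u 0 i)); exact: coord_continuous.
Qed.

(** * Bijectivity from two parametrisations exchanged by inversion *)

Section Covering.
Context {R : realType} {n : nat} {M Y : topologicalType}.
Variables (S : set Y) (F : M -> Y).
Hypotheses (hn : (2 <= n)%N) (hM : hausdorff_space M) (hY : hausdorff_space Y)
  (cM : compact [set: M]) (cF : continuous F) (SF : forall p, S (F p))
  (sF : has_local_sections S F).

Let V := 'rV[R]_n.
Let liF : locally_injective F := local_sections_injective sF.

Lemma lift_exists_from (c : V -> Y) (x0 : V) (p : M) :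
  continuous c -> (forall x, S (c x)) -> F p = c x0 ->
  exists2 G : V -> M, continuous G & F \o G =1 c /\ G x0 = p.
Proof.
move=> cc Sc Fp.
have tc (y : V) : continuous (fun x : V => x + y).
  by move=> x; apply: (@cvgD _ _ _ (nbhs x) _ id (fun=> y)); [exact: cvg_id|exact: cvg_cst].
have [|||G cG [FG G0]] := @lift_exists R V M Y S F hM hY cM cF sF (fun x => c (x + x0)) p.
- by move=> x; apply: (@continuous_comp V V Y (fun x => x + x0) c x); [exact: tc|exact: cc].
- by move=> x; exact: Sc.
- by rewrite add0r.
exists (fun x => G (x + - x0)).
  by move=> x; apply: (@continuous_comp V V M (fun x => x - x0) G x); [exact: tc|exact: cG].
by split=> [x|]; [have := FG (x - x0); rewrite /= subrK|rewrite subrr].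
Qed.

(** [G2] is started at the all-ones vector with the value that [G1 \o inversion] has there. Both
    lift [c2] away from 0, so they agree along the two segments of [nonzero_detour]. *)
Lemma compatible_lifts (c1 c2 : V -> Y) p x0 :
  continuous c1 -> continuous c2 -> (forall x, S (c1 x)) -> (forall x, S (c2 x)) ->
  (forall x, x != 0 -> c2 x = c1 (inversion x)) -> F p = c1 x0 ->
  exists G1 G2 : V -> M, [/\ continuous G1, continuous G2, F \o G1 =1 c1, F \o G2 =1 c2 &
    forall x, x != 0 -> G2 x = G1 (inversion x)].
Proof.
move=> cc1 cc2 Sc1 Sc2 c21 Fp.
have [G1 cG1 [FG1 _]] := lift_exists_from cc1 Sc1 Fp.
pose x1 : V := const_mx 1.
have x1n0 : x1 != 0.
  by apply/rV0Pn; exists (Ordinal hn); rewrite mxE oner_neq0.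
have [|G2 cG2 [FG2 G2x1]] := @lift_exists_from c2 x1 (G1 (inversion x1)) cc2 Sc2.
  by rewrite c21// -(FG1 (inversion x1)).
exists G1, G2; split=> // x xn0.
have seg (y z : V) : (forall t : R, y + t *: (z - y) != 0) ->
    G2 y = (G1 \o inversion) y -> G2 z = (G1 \o inversion) z.
  move=> yz; apply: (@lifts_agree_segment R V M Y F _ _ y z hM liF) => t _ w.
  split; first exact: cG2.
    by apply: continuous_comp; [apply: inversion_continuous; exact: yz|exact: cG1].
  by rewrite [LHS]FG2 [RHS]FG1 c21//; exact: yz.
have [w [x1w wx]] := nonzero_detour hn x1n0 xn0.
exact: seg wx (seg _ _ x1w G2x1).
Qed.

(** With [t] a local section of [c], a point [q] near [G x] equals [G (t (F q))]: both lie where [F]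
    is injective and have the same image. *)
Lemma lift_image_open (c : V -> Y) (G : V -> M) : has_local_sections S c ->
  continuous G -> F \o G =1 c -> open (range G).
Proof.
move=> sc cG FG; rewrite openE => p [x _ <-]; rewrite /interior.
have [W [t [[oW Wx] ct tW nt]]] := sc x.
have tcx : t (c x) = x := nbhs_singleton nt.
have FGx : F (G x) = c x := FG x.
have [N nN Ninj] := liF (G x).
have h1 : \forall q \near G x, W (F q).
  by apply: cF; rewrite FGx; exact: open_nbhs_nbhs.
have h2 : \forall q \near G x, N (G (t (F q))).
  have ctF : {for G x, continuous (t \o F)}.
    by apply: continuous_comp; [exact: cF|rewrite FGx; exact: ct].
  have cGtF : {for G x, continuous (G \o (t \o F))}.
    by apply: continuous_comp; [exact: ctF|exact: cG].
  by apply: cGtF; rewrite /= FGx tcx.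
near=> q.
have Wq : W (F q) by near: q; exact: h1.
have Nq : N q by near: q.
have NGq : N (G (t (F q))) by near: q; exact: h2.
exists (t (F q)) => //; apply: Ninj => //.
by rewrite [LHS]FG tW.
Unshelve. all: by end_near. Qed.

(** Once the lifts fill [M], injectivity of [F] reduces to showing that a point of [S] in both
    charts has the same lift by [G1] and by [G2]. Surjectivity is read off the cover of [S]. *)
Lemma covering_bijective (c1 c2 : V -> Y) :
  [set: M] !=set0 -> connected [set: M] ->
  continuous c1 -> continuous c2 -> (forall x, S (c1 x)) -> (forall x, S (c2 x)) ->
  has_local_sections S c1 -> has_local_sections S c2 ->
  injective c1 -> injective c2 ->
  (forall x, x != 0 -> c2 x = c1 (inversion x)) -> (forall x, c1 x <> c2 0) ->
  S `<=` range c1 `|` range c2 ->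
  set_bij [set: M] S F.
Proof.
move=> [p _] coM cc1 cc2 Sc1 Sc2 sc1 sc2 ic1 ic2 c21 c12 Scov.
have [G1 [G2 [cG1 cG2 FG1 FG2 G21]]] :
    exists G1 G2 : V -> M, [/\ continuous G1, continuous G2, F \o G1 =1 c1, F \o G2 =1 c2 &
      forall x, x != 0 -> G2 x = G1 (inversion x)].
  (* [F p] may lie in either chart; the two cases are symmetric because inversion is an
     involution. *)
  have [[x _ Fp]|[x _ Fp]] := Scov _ (SF p); first exact: (@compatible_lifts c1 c2 p x).
  have [|G2 [G1 [cG2 cG1 FG2 FG1 G12]]] := @compatible_lifts c2 c1 p x cc2 cc1 Sc2 Sc1 _ (esym Fp).
    by move=> y y0; rewrite c21 ?inversion_eq0// inversionK.
  by exists G1, G2; split=> // y y0; rewrite G12 ?inversion_eq0// inversionK.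
have GT : range G1 `|` range G2 = [set: M].
  apply: coM.
  - by exists (G1 0); left; exists 0.
  - exists (range G1 `|` range G2); last by rewrite setTI.
    by apply: openU; [exact: lift_image_open sc1 cG1 FG1|exact: lift_image_open sc2 cG2 FG2].
  - exists (range G1 `|` range G2); last by rewrite setTI.
    (* A point with [dotv x x > 1] is moved into the unit ball of the other chart by inversion, so
       two compact images already cover the union. *)
    have -> : range G1 `|` range G2 = G1 @` [set u | dotv u u <= 1] `|`
        G2 @` [set u | dotv u u <= 1].
      apply/seteqP; split => q; last by move=> [[x _ <-]|[x _ <-]]; [left|right]; exists x.
      have inv1 (x : V) : ~~ (dotv x x <= 1) -> x != 0 /\ dotv (inversion x) (inversion x) <= 1.
        rewrite -ltNge => x1; split; first by rewrite -dotv_gt0 (lt_trans _ x1).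
        by rewrite dotv_inversion invf_le1 ?(lt_trans _ x1)// ltW.
      move=> [[x _ <-]|[x _ <-]].
        have [x1|/inv1[x0 x1]] := boolP (dotv x x <= 1); first by left; exists x.
        by right; exists (inversion x) => //; rewrite G21 ?inversion_eq0// inversionK.
      have [x1|/inv1[x0 x1]] := boolP (dotv x x <= 1); first by right; exists x.
      by left; exists (inversion x) => //; rewrite G21.
    apply: closedU; apply: compact_closed => //; apply: continuous_compact.
    + exact: continuous_subspaceT.
    + exact: unit_ball_compact.
    + exact: continuous_subspaceT.
    + exact: unit_ball_compact.
split.
- by move=> q _; exact: SF.
(* [y] is not 0 because [c1] misses the pole [c2 0], so [x] is the inversion of [y]. *)
- have G12eq x y : c1 x = c2 y -> G1 x = G2 y.
    have [->/c12//|y0] := eqVneq y 0.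
    by rewrite c21// G21// => /ic1 ->.
  move=> q q' _ _ Fqq'.
  have : [set: M] q by []. have : [set: M] q' by []. rewrite -GT.
  move=> [[x' _ qx']|[x' _ qx']] [[x _ qx]|[x _ qx]]; move: Fqq'; rewrite -qx -qx'.
  + by rewrite [F (G1 x)]FG1 [F (G1 x')]FG1 => /ic1 ->.
  + by rewrite [F (G2 x)]FG2 [F (G1 x')]FG1 => /esym /G12eq ->.
  + by rewrite [F (G1 x)]FG1 [F (G2 x')]FG2 => /G12eq ->.
  + by rewrite [F (G2 x)]FG2 [F (G2 x')]FG2 => /ic2 ->.
- move=> y /Scov[[x _ <-]|[x _ <-]]; [exists (G1 x)|exists (G2 x)] => //; [exact: FG1|exact: FG2].
Qed.

End Covering.

(** * The two stereographic charts, treated together through a sign [e] with [e ^+ 2 = 1] *)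

Section Stereographic.
Context {R : realType} {n : nat}.
Variable rho : R.
Hypothesis rho0 : 0 < rho.
Implicit Types (e : R) (x : 'rV[R]_n) (y : 'rV[R]_n.+1).

(* Inverse stereographic projection from the pole [(- e * rho, 0)]. *)
Definition stereo e x : 'rV[R]_n.+1 :=
  row_mx (const_mx (e * rho * (1 - dotv x x) / (1 + dotv x x)) : 'rV_1)
         ((rho * 2 / (1 + dotv x x)) *: x).

(** On the sphere the inverted factor vanishes only at the pole, where the value is the irrelevant
    0. *)
Definition stereo_inv e y : 'rV[R]_n :=
  (rho + e * y 0 0)^-1 *: (@rsubmx R 1 1 n y).

Lemma dotv_split y :
  dotv y y = y 0 0 ^+ 2 + dotv (@rsubmx R 1 1 n y) (@rsubmx R 1 1 n y).
Proof.
rewrite /dotv big_ord_recl expr2; congr (_ + _).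
by apply: eq_bigr => i _; rewrite mxE; congr (y _ _ * y _ _); apply: val_inj.
Qed.

Lemma stereo0 e x : stereo e x 0 0 = e * rho * (1 - dotv x x) / (1 + dotv x x).
Proof.
rewrite /stereo; have -> : (0 : 'I_n.+1) = lshift n (0 : 'I_1) by apply: val_inj.
by rewrite (@row_mxEl R 1 1 n) mxE.
Qed.

Lemma stereo_r e x : @rsubmx R 1 1 n (stereo e x) = (rho * 2 / (1 + dotv x x)) *: x.
Proof. exact: row_mxKr. Qed.

Let den_gt0 x : 0 < 1 + dotv x x.
Proof. by rewrite ltr_wpDr ?dotv_ge0. Qed.

Lemma stereo_sphere e x : e ^+ 2 = 1 -> sphere n rho (stereo e x).
Proof.
move=> e2; rewrite /sphere /= /enorm dotv_split stereo0 stereo_r dotvZl dotvZr.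
rewrite -[RHS](ger0_norm (ltW rho0)) -sqrtr_sqr; congr Num.sqrt.
(* [field] does not know [e ^+ 2 = 1]; with [rho ^+ 2] written as [e ^+ 2 * rho ^+ 2], the identity
   holds for every [e]. *)
rewrite -[RHS]mul1r -[X in _ = X * _]e2; have := den_gt0 x; set q := dotv x x => q0.
have e4 : rho ^+ 2 * 4 * q = e ^+ 2 * rho ^+ 2 * 4 * q by rewrite e2 mul1r.
have -> : rho * 2 / (1 + q) * (rho * 2 / (1 + q) * q) = (rho ^+ 2 * 4 * q) / (1 + q) ^+ 2.
  by field; rewrite gt_eqF.
by rewrite e4; field; rewrite gt_eqF.
Qed.

Lemma stereoK e x : e ^+ 2 = 1 -> stereo_inv e (stereo e x) = x.
Proof.
move=> e2; rewrite /stereo_inv stereo_r stereo0 scalerA.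
have -> : e * (e * rho * (1 - dotv x x) / (1 + dotv x x)) =
    e ^+ 2 * rho * (1 - dotv x x) / (1 + dotv x x) by ring.
rewrite e2 mul1r -[RHS]scale1r; congr (_ *: _).
have := den_gt0 x; set q := dotv x x => q0.
have -> : rho + rho * (1 - q) / (1 + q) = rho * 2 / (1 + q) by field; rewrite gt_eqF.
by rewrite mulVf// !mulf_neq0 ?invr_eq0 ?gt_eqF.
Qed.

Lemma stereo_invK e y : e ^+ 2 = 1 -> rho + e * y 0 0 != 0 -> sphere n rho y ->
  stereo e (stereo_inv e y) = y.
Proof.
move=> e2 d0 Sy.
have yy : dotv (@rsubmx R 1 1 n y) (@rsubmx R 1 1 n y) = rho ^+ 2 - y 0 0 ^+ 2.
  by move: Sy; rewrite /sphere /= => <-; rewrite enorm_sqr dotv_split addrC addKr.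
have dE : dotv (stereo_inv e y) (stereo_inv e y) = (rho - e * y 0 0) / (rho + e * y 0 0).
  rewrite dotvZl dotvZr yy -[y 0 0 ^+ 2]mul1r -[X in _ - X * _]e2.
  by field.
have d1 : 1 + dotv (stereo_inv e y) (stereo_inv e y) = 2 * rho / (rho + e * y 0 0).
  by rewrite dE; field.
have d2 : 1 - dotv (stereo_inv e y) (stereo_inv e y) = 2 * (e * y 0 0) / (rho + e * y 0 0).
  by rewrite dE; field.
rewrite -[RHS](@hsubmxK R 1 1 n) /stereo d1 d2.
apply: (congr2 (@row_mx R 1 1 n)).
  apply/matrixP => i j; rewrite !mxE !ord1.
  have -> : lshift n 0 = 0 :> 'I_(1 + n) by apply: val_inj.
  rewrite -[RHS]mul1r -[X in _ = X * _]e2.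
  by field; rewrite d0 gt_eqF.
rewrite /stereo_inv scalerA -[RHS]scale1r; congr (_ *: _).
by field; rewrite d0 gt_eqF.
Qed.

Lemma stereo_continuous e : continuous (stereo e).
Proof.
move=> x.
have cd : (1 + dotv z z)^-1 @[z --> x] --> (1 + dotv x x)^-1.
  apply: (@cvgV _ _ (nbhs x) _ (fun z => 1 + dotv z z) (1 + dotv x x)).
    by rewrite gt_eqF.
  exact: (cvgD (cvg_cst _) (@dotvv_continuous R n x)).
have stereoE z : stereo e z = (e * rho * (1 - dotv z z) / (1 + dotv z z)) *: delta_mx 0 0 +
    (rho * 2 / (1 + dotv z z)) *: (z *m row_mx (0 : 'cV[R]_n) 1%:M).
  rewrite /stereo mul_mx_row mulmx0 mulmx1.
  have -> : delta_mx 0 0 = row_mx (const_mx 1 : 'rV_1) (0 : 'rV_n) :> 'rV[R]_(1 + n).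
    apply/rowP => i; rewrite !mxE; case: splitP => j ij; rewrite !mxE -!val_eqE /= ij ?ord1//.
  rewrite !(@scale_row_mx R 1 1 n) (@add_row_mx R 1 1 n) !scaler0 addr0 add0r.
  apply: (congr2 (@row_mx R 1 1 n)) => //.
  by apply/matrixP => i j; rewrite !mxE mulr1.
rewrite /continuous_at (funext stereoE).
have cM : z *m row_mx (0 : 'cV[R]_n) 1%:M @[z --> x] --> x *m row_mx (0 : 'cV[R]_n) 1%:M.
  exact: (@linear_rV_continuous R n 'rV[R]_(1 + n) (mulmxr (row_mx (0 : 'cV_n) 1%:M)) x).
have ca : 1 - dotv z z @[z --> x] --> 1 - dotv x x.
  exact: (cvgB (cvg_cst _) (@dotvv_continuous R n x)).
have c1 : e * rho * (1 - dotv z z) / (1 + dotv z z) @[z --> x] -->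
    e * rho * (1 - dotv x x) / (1 + dotv x x).
  exact: cvgM (cvgM (cvg_cst _) ca) cd.
have c2 : rho * 2 / (1 + dotv z z) @[z --> x] --> rho * 2 / (1 + dotv x x).
  exact: cvgM (cvg_cst _) cd.
exact: cvgD (cvgZr_tmp c1) (cvgZ c2 cM).
Qed.

Lemma stereo_local_sections e : e ^+ 2 = 1 -> has_local_sections (sphere n rho) (stereo e).
Proof.
move=> e2 x.
have ce : continuous (fun y : 'rV[R]_n.+1 => rho + e * y 0 0).
  move=> y; have ct := @coord_continuous R 1 n.+1 0 0 y.
  exact: cvgD (cvg_cst rho) (cvgM (cvg_cst e) ct).
exists [set y : 'rV[R]_n.+1 | rho + e * y 0 0 != 0], (stereo_inv e); split.
- split.
    apply: (@open_comp _ _ _ [set r : R | r != 0]) => [y _|]; first exact: ce.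
    exact: open_neq.
  rewrite /= stereo0; have := den_gt0 x; set q := dotv x x => q0.
  have -> : rho + e * (e * rho * (1 - q) / (1 + q)) = rho * (1 + q + e ^+ 2 * (1 - q)) / (1 + q).
    by field; rewrite gt_eqF.
  rewrite e2 mul1r; have -> : 1 + q + (1 - q) = 2 :> R by ring.
  by rewrite !mulf_neq0 ?invr_eq0 ?gt_eqF.
- move=> y /= y0.
  have cv : (rho + e * z 0 0)^-1 @[z --> y] --> (rho + e * y 0 0)^-1.
    by apply: (@cvgV _ _ (nbhs y) _ (fun z : 'rV[R]_n.+1 => rho + e * z 0 0)) => //; exact: ce.
  have cr : (fun z : 'rV[R]_n.+1 => @rsubmx R 1 1 n z) @ y --> @rsubmx R 1 1 n y.
    exact: (@continuous_rsubmx R 1 1 n y).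
  exact: (@cvgZ R 'rV[R]_n 'rV[R]_n.+1 (nbhs y) (nbhs_filter y) _ _ _ _ cv cr).
- by move=> y /= y0 Sy; rewrite stereo_invK.
- by apply: (@filterE _ (nbhs x) (nbhs_filter x)) => z; rewrite stereoK.
Qed.

Lemma stereo_inversion x : x != 0 -> stereo (-1) x = stereo 1 (inversion x).
Proof.
rewrite -dotv_gt0 /stereo dotv_inversion /inversion scalerA.
set q := dotv x x => q0.
apply: (congr2 (@row_mx R 1 1 n)); last congr (_ *: _).
  by congr const_mx; field; rewrite !gt_eqF// addr_gt0.
by field; rewrite !gt_eqF// addr_gt0.
Qed.

Lemma stereo_pole x : stereo 1 x <> stereo (-1) 0.
Proof.
move=> /(congr1 (fun y : 'rV_n.+1 => y 0 0)); rewrite !stereo0 dotv0l subr0 addr0 divr1 mulr1.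
have := den_gt0 x; set q := dotv x x => q0 /eqP; rewrite -subr_eq0.
have -> : 1 * rho * (1 - q) / (1 + q) - (-1) * rho = rho * 2 / (1 + q).
  by field; rewrite gt_eqF.
by rewrite !mulf_eq0 invr_eq0 !gt_eqF.
Qed.

Lemma stereo_cover : sphere n rho `<=` range (stereo 1) `|` range (stereo (-1)).
Proof.
move=> y Sy; have [y0|y0] := eqVneq (rho + y 0 0) 0.
  right; exists (stereo_inv (-1) y) => //; apply: stereo_invK => //.
    by rewrite sqrrN expr1n.
  by apply/eqP; move: rho0; lra.
left; exists (stereo_inv 1 y) => //; apply: stereo_invK => //; first by rewrite expr1n.
by rewrite mul1r.
Qed.

End Stereographic.

Lemma sphere_covering_bijective {R : realType} {n : nat} {rho : R} {M : topologicalType}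
    (F : M -> 'rV[R]_n.+1) :
  (2 <= n)%N -> 0 < rho -> hausdorff_space M -> compact [set: M] ->
  connected [set: M] -> [set: M] !=set0 -> continuous F ->
  (forall p, sphere n rho (F p)) -> has_local_sections (sphere n rho) F ->
  set_bij [set: M] (sphere n rho) F.
Proof.
move=> hn rho0 hM cM coM M0 cF SF sF.
have e1 : 1 ^+ 2 = 1 :> R by rewrite expr1n.
have eN1 : (- 1) ^+ 2 = 1 :> R by rewrite sqrrN expr1n.
have hY : hausdorff_space 'rV[R]_n.+1 by exact: norm_hausdorff.
apply: (@covering_bijective R n M 'rV[R]_n.+1 (sphere n rho) F hn hM hY cM cF SF sF
  (stereo rho 1) (stereo rho (-1))) => //.
- exact: stereo_continuous.
- exact: stereo_continuous.
- by move=> x; exact: stereo_sphere.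
- by move=> x; exact: stereo_sphere.
- exact: stereo_local_sections.
- exact: stereo_local_sections.
- exact: can_inj (fun x => stereoK rho0 x e1).
- exact: can_inj (fun x => stereoK rho0 x eN1).
- by move=> x; exact: stereo_inversion.
- by move=> x; exact: stereo_pole.
- exact: stereo_cover.
Qed.
(** * Calculus of C^k maps and the inverse function theorem *)

Lemma near_norm_ball {R : realType} {V : normedModType R} (x : V) (P : set V) :
  (\forall y \near x, P y) -> exists2 r : R, 0 < r & forall y, `|x - y| < r -> P y.
Proof.
by move/nbhs_ballP => [r r0 Hr]; exists r => // y xr; apply: Hr; rewrite -ball_normE.
Qed.

Lemma norm_ball_near {R : realType} {V : normedModType R} (x : V) (r : R) (P : set V) :
  0 < r -> (forall y, `|x - y| < r -> P y) -> \forall y \near x, P y.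
Proof.
by move=> r0 Hr; apply/nbhs_ballP; exists r => //= y; rewrite -ball_normE; exact: Hr.
Qed.

Lemma near0_shift {R : realType} {V : normedModType R} (U : set V) (x : V) :
  open U -> U x -> \forall h \near (0 : V), U (h + x).
Proof.
move=> oU Ux.
have cx : (fun h : V => h + x) @ 0 --> (0 + x).
  by apply: (@cvgD _ _ _ (nbhs (0 : V)) _ id (fun=> x)); [exact: cvg_id|exact: cvg_cst].
by apply: cx; rewrite add0r; exact: open_nbhs_nbhs.
Qed.

Section Differentiability.
Context {R : realType} {V W : normedModType R}.
Implicit Types f g : V -> W.

Lemma diff_expansion f (x : V) : differentiable f x ->
  forall e : R, 0 < e -> \forall h \near (0 : V), `|f (h + x) - f x - 'd f x h| <= e * `|h|.
Proof.
move=> df e e0; have := diff_locally df => /eqaddoP /(_ e e0).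
by apply: filterS => h; rewrite /= opprD addrA.
Qed.

Lemma expansion_diff f (x : V) (A : {linear V -> W}) : continuous A ->
  (forall e : R, 0 < e -> \forall h \near (0 : V), `|f (h + x) - f x - A h| <= e * `|h|) ->
  differentiable f x /\ 'd f x = A :> (V -> W).
Proof.
move=> cA H.
have fE : f \o shift x = cst (f x) + A +o_ 0 id.
  apply/eqaddoP => e e0; have := H e e0.
  by apply: filterS => h; rewrite /= opprD addrA.
have dE := diff_unique cA fE.
split=> //; apply/diff_locallyP; rewrite dE; split=> //.
Qed.

Lemma differentiable_eq_on (U : set V) f g (x : V) :
  open U -> U x -> (forall y, U y -> f y = g y) ->
  differentiable f x -> differentiable g x.
Proof.
move=> oU Ux fg df.
have [|//] := @expansion_diff g x ('d f x) (diff_continuous df).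
move=> e e0; have h1 := diff_expansion df e0.
have h2 := near0_shift oU Ux.
by apply: filterS2 h1 h2 => h + Uh; rewrite !fg.
Qed.

Lemma derive_eq_on (U : set V) f g (x v : V) :
  open U -> U x -> (forall y, U y -> f y = g y) -> 'D_v f x = 'D_v g x.
Proof.
move=> oU Ux fg; apply: near_eq_derive.
have : nbhs x U by exact: open_nbhs_nbhs.
by apply: filterS => y; exact: fg.
Qed.

End Differentiability.

(** * Closure properties of C^k maps on an open set *)

Section Ck.
Context {R : realType} {V : normedModType R}.
Variable U : set V.
Hypothesis oU : open U.

(** Since [U] is open, equality on [U] passes to differentials there. Each derivative formula below,
    valid only on [U], re-enters the induction on [k] through this lemma. *)
Lemma Ck_on_eq {W : normedModType R} k (f g : V -> W) :
  (forall x, U x -> f x = g x) -> Ck_on k U f -> Ck_on k U g.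
Proof.
elim: k f g => [|k IH] f g fg /=.
  by move=> cf x Ux; apply: (continuous_at_eq_on oU Ux fg); exact: cf.
move=> [df Df]; split=> [x Ux|v].
  exact: (differentiable_eq_on oU Ux fg (df x Ux)).
by apply: IH (Df v) => x Ux; exact: (derive_eq_on _ oU Ux fg).
Qed.

Lemma Ck_on_continuous {W : normedModType R} k (f : V -> W) x :
  Ck_on k U f -> U x -> {for x, continuous f}.
Proof.
by case: k => [cf /cf//|k [df _] Ux]; exact: differentiable_continuous (df x Ux).
Qed.

Lemma Ck_onW {W : normedModType R} k (f : V -> W) : Ck_on k.+1 U f -> Ck_on k U f.
Proof.
elim: k f => [|k IH] f [df Df].
  by move=> x Ux; exact: differentiable_continuous (df x Ux).
by split=> // v; exact: IH.
Qed.

Lemma Ck_on_cst {W : normedModType R} k (c : W) : Ck_on k U (fun=> c).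
Proof.
elim: k c => [|k IH] c /=; first by move=> x _; exact: cst_continuous.
split=> [x _|v]; first exact: differentiable_cst.
by apply: Ck_on_eq (IH 0) => x _; rewrite derive_cst.
Qed.

Lemma Ck_on_linear {W W' : normedModType R} (L : {linear W -> W'}) k (f : V -> W) :
  continuous L -> Ck_on k U f -> Ck_on k U (L \o f).
Proof.
move=> cL; elim: k f => [|k IH] f /=.
  by move=> cf x Ux; apply: continuous_comp; [exact: cf|exact: cL].
move=> [df Df]; split=> [x Ux|v].
  by apply: differentiable_comp; [exact: df|exact: linear_differentiable].
apply: Ck_on_eq (IH _ (Df v)) => x Ux.
have dL : differentiable L (f x) by exact: linear_differentiable.
rewrite deriveE; last by apply: differentiable_comp; [exact: df|].
by rewrite diff_comp//; [rewrite /= diff_lin// deriveE//; exact: df|exact: df].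
Qed.

Lemma Ck_on_id k : Ck_on k U id.
Proof.
case: k => [|k] /=; first by move=> x _; exact: cvg_id.
split=> [x _|v]; first by apply: ex_diff.
by apply: Ck_on_eq (Ck_on_cst k v) => x _; rewrite derive_id.
Qed.

Lemma Ck_on_add {W : normedModType R} k (f g : V -> W) :
  Ck_on k U f -> Ck_on k U g -> Ck_on k U (fun x => f x + g x).
Proof.
elim: k f g => [|k IH] f g /=.
  by move=> cf cg x Ux; apply: continuousD; [exact: cf|exact: cg].
move=> [df Df] [dg Dg]; split=> [x Ux|v].
  by apply: differentiableD; [exact: df|exact: dg].
apply: Ck_on_eq (IH _ _ (Df v) (Dg v)) => x Ux.
by rewrite -deriveD//; apply: diff_derivable; [exact: df|exact: dg].
Qed.

Lemma Ck_on_mul k (f g : V -> R) :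
  Ck_on k U f -> Ck_on k U g -> Ck_on k U (fun x => f x * g x).
Proof.
elim: k f g => [|k IH] f g.
  by move=> cf cg x Ux; apply: continuousM; [exact: cf|exact: cg].
move=> Cf Cg; have [df Df] := Cf; have [dg Dg] := Cg.
split=> [x Ux|v].
  by apply: differentiableM; [exact: df|exact: dg].
apply: Ck_on_eq (Ck_on_add (IH _ _ (Ck_onW Cf) (Dg v)) (IH _ _ (Ck_onW Cg) (Df v))) => x Ux.
by rewrite [RHS]deriveM//; apply: diff_derivable; [exact: df|exact: dg].
Qed.

Lemma Ck_on_opp {W : normedModType R} k (f : V -> W) :
  Ck_on k U f -> Ck_on k U (fun x => - f x).
Proof.
elim: k f => [|k IH] f /=; first by move=> cf x Ux; apply: continuousN; exact: cf.
move=> [df Df]; split=> [x Ux|v]; first by apply: differentiableN; exact: df.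
apply: Ck_on_eq (IH _ (Df v)) => x Ux.
by rewrite -deriveN//; apply: diff_derivable; exact: df.
Qed.

Lemma Ck_on_inv k (f : V -> R) : (forall x, U x -> f x != 0) ->
  Ck_on k U f -> Ck_on k U (fun x => (f x)^-1).
Proof.
move=> f0; elim: k => [|k IH].
  by move=> cf x Ux; apply: continuousV; [exact: f0|exact: cf].
move=> Cf; have [df Df] := Cf; have Ci := IH (Ck_onW Cf).
split=> [x Ux|v]; first by apply: differentiableV; [exact: df|exact: f0].
apply: Ck_on_eq (Ck_on_opp (Ck_on_mul (Ck_on_mul Ci Ci) (Df v))) => x Ux.
rewrite [RHS]deriveV//; [|exact: f0|by apply: diff_derivable; exact: df].
by rewrite -[_ *: _]/(_ * _) mulNr expr2 invfM.
Qed.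

Lemma Ck_on_sum {W : normedModType R} k (I : Type) (r : seq I) (f : I -> V -> W) :
  (forall i, Ck_on k U (f i)) -> Ck_on k U (fun x => \sum_(i <- r) f i x).
Proof.
move=> Cf; elim: r => [|i r IH].
  by apply: Ck_on_eq (Ck_on_cst k 0) => x _; rewrite big_nil.
by apply: Ck_on_eq (Ck_on_add (Cf i) IH) => x _; rewrite big_cons.
Qed.

Lemma Ck_on_prod k (I : Type) (r : seq I) (f : I -> V -> R) :
  (forall i, Ck_on k U (f i)) -> Ck_on k U (fun x => \prod_(i <- r) f i x).
Proof.
move=> Cf; elim: r => [|i r IH].
  by apply: Ck_on_eq (Ck_on_cst k (1 : R)) => x _; rewrite big_nil.
by apply: Ck_on_eq (Ck_on_mul (Cf i) IH) => x _; rewrite big_cons.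
Qed.

Lemma Ck_on_det k m (A : V -> 'M[R]_m) :
  (forall i j, Ck_on k U (fun x => A x i j)) -> Ck_on k U (fun x => \det (A x)).
Proof.
move=> CA; apply: Ck_on_sum => s; apply: Ck_on_mul; first exact: Ck_on_cst.
by apply: Ck_on_prod => i; exact: CA.
Qed.

Lemma Ck_on_coord k m (f : V -> 'rV[R]_m) i :
  Ck_on k U f -> Ck_on k U (fun x => f x 0 i).
Proof.
move=> Cf.
have cl : linear (fun u : 'rV[R]_m => u 0 i : R) by move=> a u v; rewrite !mxE.
pose cL : {linear 'rV[R]_m -> R} :=
  HB.pack (fun u : 'rV[R]_m => u 0 i : R) (GRing.isLinear.Build _ _ _ _ _ cl).
have -> : (fun x => f x 0 i) = cL \o f by [].
by apply: Ck_on_linear Cf; exact: coord_continuous.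
Qed.

Lemma Ck_on_rV k m (f : V -> 'rV[R]_m) :
  (forall i, Ck_on k U (fun x => f x 0 i)) -> Ck_on k U f.
Proof.
move=> Cf.
have Cs i : Ck_on k U (fun x => f x 0 i *: (delta_mx 0 i : 'rV[R]_m)).
  have cl : linear (fun a : R => a *: (delta_mx 0 i : 'rV[R]_m)).
    by move=> a u v; rewrite scalerDl scalerA.
  pose cL : {linear R -> 'rV[R]_m} :=
    HB.pack (fun a : R => a *: (delta_mx 0 i : 'rV[R]_m)) (GRing.isLinear.Build _ _ _ _ _ cl).
  have -> : (fun x => f x 0 i *: (delta_mx 0 i : 'rV[R]_m)) = cL \o (fun x => f x 0 i) by [].
  by apply: Ck_on_linear (Cf i); exact: scalel_continuous.
apply: Ck_on_eq (Ck_on_sum (index_enum 'I_m) Cs) => x _.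
by rewrite [RHS]row_sum_delta.
Qed.

End Ck.

Lemma diff_sum_delta {R : realType} {m : nat} {W : normedModType R}
    (f : 'rV[R]_m -> W) (x v : 'rV[R]_m) :
  differentiable f x -> 'd f x v = \sum_i v 0 i *: 'D_(delta_mx 0 i) f x.
Proof.
move=> df; rewrite [in LHS](row_sum_delta v) linear_sum.
by apply: eq_bigr => i _; rewrite linearZ deriveE.
Qed.

(** The chain rule writes the derivative as a sum of products of scalar functions [('D_v f) 0 i] and
    [('D_i g) \o f], so the induction on [k] closes on scalar [g]. *)
Lemma Ck_on_comp_scalar {R : realType} {V : normedModType R} {m : nat} k
    (U : set V) (U' : set 'rV[R]_m) (f : V -> 'rV[R]_m) (g : 'rV[R]_m -> R) :
  open U -> open U' -> (forall x, U x -> U' (f x)) ->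
  Ck_on k U f -> Ck_on k U' g -> Ck_on k U (g \o f).
Proof.
move=> oU oU' fU; elim: k g => [|k IH] g.
  by move=> cf cg x Ux; apply: continuous_comp; [exact: cf|apply: cg; exact: fU].
move=> Cf Cg; have [df Df] := Cf; have [dg Dg] := Cg.
split=> [x Ux|v].
  by apply: differentiable_comp; [exact: df|apply: dg; exact: fU].
have Ci i : Ck_on k U (fun x => ('D_v f x) 0 i * ('D_(delta_mx 0 i) g \o f) x).
  apply: Ck_on_mul => //; first exact: Ck_on_coord (Df v).
  exact: IH (Ck_onW Cf) (Dg _).
apply: Ck_on_eq (Ck_on_sum oU (index_enum 'I_m) Ci) => // x Ux.
have dfx := df x Ux; have dgx := dg _ (fU _ Ux).
rewrite [RHS]deriveE; last exact: differentiable_comp.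
by rewrite diff_comp//= diff_sum_delta// -deriveE.
Qed.

Lemma Ck_on_comp {R : realType} {V : normedModType R} {m p : nat} k
    (U : set V) (U' : set 'rV[R]_m) (f : V -> 'rV[R]_m) (g : 'rV[R]_m -> 'rV[R]_p) :
  open U -> open U' -> (forall x, U x -> U' (f x)) ->
  Ck_on k U f -> Ck_on k U' g -> Ck_on k U (g \o f).
Proof.
move=> oU oU' fU Cf Cg; apply: Ck_on_rV => // i.
exact: (@Ck_on_comp_scalar _ _ _ k U U' f (fun y => g y 0 i) oU oU' fU Cf (Ck_on_coord oU' i Cg)).
Qed.

(** * The sup norm and the mean value inequality *)

Section RowNorm.
Context {R : realType} {m : nat}.
Implicit Type u : 'rV[R]_m.

Lemma coord_le_norm u i : `|u 0 i| <= `|u|.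
Proof. by rewrite [leRHS]/Num.Def.normr /= mx_normrE (le_bigmax _ (fun i => `|u i.1 i.2|) (0, i)). Qed.

Lemma norm_le_coord u (c : R) : 0 <= c -> (forall i, `|u 0 i| <= c) -> `|u| <= c.
Proof.
move=> c0 H; rewrite [leLHS]/Num.Def.normr /= mx_normrE; apply: bigmax_le => // -[i j] _.
by rewrite /= ord1.
Qed.

End RowNorm.

Section MeanValue.
Context {R : realType} {m : nat}.

(** For the sup norm it suffices to bound each coordinate, and each one restricted to the segment is
    a real function of one variable. *)
Lemma mean_value_le {V : normedModType R} (g : V -> 'rV[R]_m) (x y : V) (c : R) :
  (forall t, 0 <= t <= 1 -> differentiable g (y + t *: (x - y)) /\
    `|'d g (y + t *: (x - y)) (x - y)| <= c) ->
  `|g x - g y| <= c.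
Proof.
move=> H.
have c0 : 0 <= c.
  have /H[_] : 0 <= (0 : R) <= 1 by rewrite lexx ler01.
  exact: le_trans.
apply: norm_le_coord => // j.
pose p (t : R) : V := y + t *: (x - y).
pose phi (t : R) : R := g (p t) 0 j.
have dp (t : R) : differentiable p t /\ 'd p t 1 = x - y.
  have dpt : is_diff t (cst y + ( *:%R ^~ (x - y))) (0 + ( *:%R ^~ (x - y))).
    exact: is_diffD.
  split; first exact: (@ex_diff _ _ _ _ _ _ _ dpt).
  have := @diff_val _ _ _ _ _ _ _ dpt => /(congr1 (fun k => k 1)) /= ->.
  by rewrite fctE add0r scale1r.
have dgp (t : R) : 0 <= t <= 1 -> differentiable (g \o p) t.
  by move=> t01; apply: differentiable_comp; [have [] := dp t|have [] := H t t01].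
have dphi (t : R) : 0 <= t <= 1 -> is_derive t 1 phi (('d g (p t) (x - y)) 0 j).
  move=> t01; have [dpt pE] := dp t; have [dg _] := H t t01.
  have dgpt := dgp t t01.
  have dph : derivable phi t 1.
    have /derivable_mxP/(_ 0 j) : derivable (g \o p) t 1 by exact: diff_derivable.
    by [].
  apply: DeriveDef => //.
  have <- : 'D_1 (g \o p) t = 'd g (p t) (x - y) by rewrite deriveE// diff_comp//= pE.
  by rewrite derive_mx ?mxE//; exact: diff_derivable.
have [t| |t tI] := @MVT_segment R phi (fun t => ('d g (p t) (x - y)) 0 j) 0 1 ler01.
- by rewrite in_itv /= => /andP[t0 t1]; apply: dphi; rewrite !ltW.
- apply: derivable_within_continuous => t; rewrite in_itv /= => t01.
  by have [] := dphi t t01.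
rewrite subr0 mulr1 /phi /p scale1r scale0r addr0 [y + (x - y)]addrC subrK => E.
rewrite !mxE E; apply: le_trans (coord_le_norm _ _) _.
by move: tI; rewrite in_itv /= => /H[].
Qed.

End MeanValue.

(** * The inverse function theorem *)

Section InverseFunction.
Context {R : realType} {m : nat}.
Implicit Types (f h : 'rV[R]_m -> 'rV[R]_m) (x y u v : 'rV[R]_m).

Lemma diff_jacobian f x u : 'd f x u = u *m jacobian f x.
Proof. by rewrite mul_rV_lin1. Qed.

Lemma jacobian_coord f x i j : differentiable f x ->
  jacobian f x i j = ('D_(delta_mx 0 i) f x) 0 j.
Proof. by move=> df; rewrite deriveEjacobian// -rowE [RHS]mxE. Qed.

(** For an increment [k] of [y] and [l = h (k + y) - h y], the expansion of [f] gives
    [k - l J = o(l)]; the Lipschitz bound on [h] turns this into [o(k)], and [J^-1] is applied. *)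
Lemma inverse_differentiable f h (W : set 'rV[R]_m) y (C : R) :
  open W -> W y -> (forall z, W z -> f (h z) = z) -> differentiable f (h y) ->
  jacobian f (h y) \in unitmx -> 0 < C ->
  (forall z, W z -> `|h z - h y| <= C * `|z - y|) ->
  differentiable h y /\ 'd h y = mulmxr (invmx (jacobian f (h y))) :> ('rV[R]_m -> 'rV[R]_m).
Proof.
move=> oW Wy fh df Ju C0 hC.
set A := invmx _.
have cA : continuous (mulmxr A : 'rV[R]_m -> 'rV[R]_m) by exact: linear_rV_continuous.
apply: expansion_diff => // e e0.
have [K K0 HK] := linear_lipschitz cA.
(* [K] bounds the inverse Jacobian and [C] bounds [h]; dividing by both makes the final error
   [e * |k|]. *)
have e'0 : 0 < e / (K * C) by rewrite divr_gt0// mulr_gt0.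
have Hf := diff_expansion df e'0.
have nW := near0_shift oW Wy.
have [d d0 Hd] := near_norm_ball Hf.
have nd : \forall k \near (0 : 'rV[R]_m), `|k| < d / C.
  apply: (norm_ball_near (r := d / C)) => [|k]; first by rewrite divr_gt0.
  by rewrite sub0r normrN.
apply: filterS2 nW nd => k Wk kd /=.
set l := h (k + y) - h y.
have lk : `|l| <= C * `|k| by have := hC _ Wk; rewrite addrK.
have ld : `|l| < d by apply: le_lt_trans lk _; rewrite mulrC -ltr_pdivlMr.
have := Hd l; rewrite sub0r normrN => /(_ ld); rewrite /l subrK !fh// addrK diff_jacobian -/l => Hl.
have -> : l - k *m A = - (mulmxr A (k - l *m jacobian f (h y))).
  by rewrite /= mulmxBl mulmxK// opprB.
rewrite normrN; apply: le_trans (HK _) _; apply: le_trans (ler_wpM2l (ltW K0) Hl) _.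
apply: (@le_trans _ _ (K * (e / (K * C) * (C * `|k|)))).
  by rewrite !ler_wpM2l// ltW.
have -> // : K * (e / (K * C) * (C * `|k|)) = e * `|k|.
by field; rewrite !gt_eqF.
Qed.

(** Bootstrapping: by Cramer's formula ['d h] is rational in the entries of the Jacobian of [f]
    along [h], so [h] of class C^k makes ['d h] of class C^k. *)
Lemma inverse_smooth f h (U W : set 'rV[R]_m) :
  open U -> open W -> smooth_on U f -> (forall y, W y -> U (h y)) ->
  (forall y, W y -> jacobian f (h y) \in unitmx) ->
  (forall y, W y -> differentiable h y /\
    'd h y = mulmxr (invmx (jacobian f (h y))) :> ('rV[R]_m -> 'rV[R]_m)) ->
  smooth_on W h.
Proof.
move=> oU oW sf hU Ju dh; elim=> [|k IH].
  by move=> y Wy; apply: differentiable_continuous; have [] := dh y Wy.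
split=> [y Wy|v]; first by have [] := dh y Wy.
have CJ i j : Ck_on k W (fun y => jacobian f (h y) i j).
  have [df Df] := sf k.+1.
  have Cc := Ck_on_comp oW oU hU IH (Df (delta_mx 0 i)).
  apply: Ck_on_eq (Ck_on_coord oW j Cc) => // y Wy.
  by rewrite jacobian_coord//; apply: df; exact: hU.
have Cdet : Ck_on k W (fun y => (\det (jacobian f (h y)))^-1).
  apply: Ck_on_inv => //; last exact: Ck_on_det.
  by move=> y Wy; have := Ju y Wy; rewrite unitmxE unitfE.
have Cadj i j : Ck_on k W (fun y => (\adj (jacobian f (h y))) i j).
  have Cm : Ck_on k W (fun y => cofactor (jacobian f (h y)) j i).
    rewrite /cofactor; apply: Ck_on_mul => //; first exact: Ck_on_cst.
    apply: Ck_on_det => // a b.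
    by apply: Ck_on_eq (CJ (lift j a) (lift i b)) => // y _; rewrite !mxE.
  by apply: Ck_on_eq Cm => // y _; rewrite mxE.
apply: Ck_on_rV => // j.
have Cs i : Ck_on k W (fun y => v 0 i * ((\det (jacobian f (h y)))^-1 *
    (\adj (jacobian f (h y))) i j)).
  by apply: Ck_on_mul => //; [exact: Ck_on_cst|exact: Ck_on_mul].
apply: Ck_on_eq (Ck_on_sum oW (index_enum 'I_m) Cs) => // y Wy.
have [dhy dhE] := dh y Wy; rewrite deriveE// dhE /= [RHS]mxE.
by apply: eq_bigr => i _; rewrite /invmx Ju// [X in _ = _ * X]mxE.
Qed.

(** The map [g x = x - f x *m B], with [B] the inverse Jacobian at [x0], has zero differential at
    [x0], hence is 1/2-Lipschitz on a small ball: up to [B], [f] is a small perturbation of the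
    identity. *)
Lemma inverse_function f (U : set 'rV[R]_m) x0 :
  open U -> U x0 -> smooth_on U f -> injective ('d f x0) ->
  exists (W : set 'rV[R]_m) h, [/\ open W /\ W (f x0),
    forall y, W y -> U (h y) /\ f (h y) = y, smooth_on W h &
    \forall x \near x0, h (f x) = x].
Proof.
move=> oU Ux0 sf inj.
have [df Df1] := sf 1%N.
have Df v : Ck_on 0 U (fun x => 'D_v f x) by exact: Df1.
have J0 : jacobian f x0 \in unitmx.
  rewrite -row_free_unit; apply/inj_row_free => v vJ.
  by apply: inj; rewrite linear0 diff_jacobian.
set B := invmx (jacobian f x0).
pose g x := x - f x *m B.
(* A matrix with entries at most [c] has sup-operator norm at most [m c <= 1/2]; the added 1 covers
   [m = 0]. *)
pose c : R := (2 * m%:R + 1)^-1.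
have c0 : 0 < c by rewrite invr_gt0 ltr_wpDl// mulr_ge0.
have CJ i j : Ck_on 0 U (fun x => jacobian f x i j).
  apply: Ck_on_eq (Ck_on_coord oU j (Df (delta_mx 0 i))) => // x Ux.
  by rewrite jacobian_coord//; exact: df.
have nU : \forall x \near x0, U x by exact: open_nbhs_nbhs.
have nJ : \forall x \near x0, jacobian f x \in unitmx.
  have cdet := Ck_on_continuous (Ck_on_det oU CJ) Ux0.
  have : \forall d \near \det (jacobian f x0), d != 0.
    apply: open_nbhs_nbhs; split; first exact: open_neq.
    by move: J0; rewrite unitmxE unitfE.
  by move=> /cdet; apply: (@filterS _ (nbhs x0) (nbhs_filter x0)) => x; rewrite unitmxE unitfE.
have nK : \forall x \near x0, forall ij : 'I_m * 'I_m,
    `|(1%:M - jacobian f x *m B) ij.1 ij.2| <= c.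
  apply: (@filter_forall _ _ _ (nbhs x0) (nbhs_filter x0)) => -[i j] /=.
  have CK : Ck_on 0 U (fun x => (1%:M : 'M[R]_m) i j + - \sum_l jacobian f x i l * B l j).
    apply: Ck_on_add => //; first exact: Ck_on_cst.
    apply: Ck_on_opp => //; apply: Ck_on_sum => // l.
    by apply: Ck_on_mul => //; exact: Ck_on_cst.
  have cK := Ck_on_continuous CK Ux0.
  have KE x : (1%:M - jacobian f x *m B) i j =
      (1%:M : 'M[R]_m) i j + - \sum_l jacobian f x i l * B l j by rewrite !mxE.
  have : \forall d \near (1%:M : 'M[R]_m) i j + - \sum_l jacobian f x0 i l * B l j, `|d| <= c.
    rewrite -KE mulmxV// subrr mxE; apply: (norm_ball_near c0) => d.
    by rewrite sub0r normrN => /ltW.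
  by move=> /cK; apply: (@filterS _ (nbhs x0) (nbhs_filter x0)) => x; rewrite KE.
have nn : \forall x \near x0, [/\ U x, jacobian f x \in unitmx &
    forall i j, `|(1%:M - jacobian f x *m B) i j| <= c].
  apply: (@filterS3 _ (nbhs x0) (nbhs_filter x0) _ _ _ _ _ nU nJ nK) => x Ux Jx Kx.
  by split=> // i j; exact: Kx (i, j).
have [r0 r00 Hr0] := near_norm_ball nn.
pose r := r0 / 2.
have rpos : 0 < r by rewrite divr_gt0.
have Hr x : `|x0 - x| <= r -> [/\ U x, jacobian f x \in unitmx &
    forall i j, `|(1%:M - jacobian f x *m B) i j| <= c].
  by move=> xr; apply: Hr0; apply: le_lt_trans xr _; rewrite /r; lra.
have gcontr x y : `|x0 - x| <= r -> `|x0 - y| <= r -> `|g x - g y| <= 2^-1 * `|x - y|.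
  move=> xr yr; apply: mean_value_le => t t01.
  have [Uz Jz Kz] := Hr _ (segment_in_ball yr xr t01).
  set z := y + _ in Uz Jz Kz *.
  have dgz : differentiable g z /\ 'd g z (x - y) = (x - y) *m (1%:M - jacobian f z *m B).
    have dfz := df _ Uz.
    have cB : continuous (mulmxr B : 'rV[R]_m -> 'rV[R]_m) by exact: linear_rV_continuous.
    pose b : 'rV[R]_m -> 'rV[R]_m := mulmxr B.
    have db : is_diff (f z) b b.
      by apply: DiffDef; [exact: linear_differentiable|exact: diff_lin].
    have dfz' : is_diff z f ('d f z) by apply: DiffDef.
    have dgz : is_diff z (id - (b \o f)) (id - (b \o 'd f z)) by exact: is_diffB.
    split; first exact: (@ex_diff _ _ _ _ _ _ _ dgz).
    have := @diff_val _ _ _ _ _ _ _ dgz => /(congr1 (fun k => k (x - y))) E.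
    by rewrite [LHS]E !fctE /b /= diff_jacobian mulmxBr mulmx1 mulmxA.
  split; first by case: dgz.
  rewrite dgz.2; apply: norm_le_coord => [|j]; first by rewrite mulr_ge0.
  rewrite mxE; apply: le_trans (ler_norm_sum _ _ _) _.
  apply: (@le_trans _ _ (\sum_(i < m) `|x - y| * c)).
    by apply: ler_sum => i _; rewrite normrM ler_pM// coord_le_norm.
  rewrite sumr_const card_ord -[leLHS]mulr_natr -mulrA [leRHS]mulrC ler_wpM2l//.
  rewrite /c mulrC ler_pdivrMr ?ltr_wpDl// ?mulr_ge0//.
  by rewrite mulrDr mulrA mulVf ?mul1r ?mulr1 ?lerDl ?invr_ge0// pnatr_eq0.
(* The contraction [g] absorbs half of [|x - y|]. This yields injectivity of [f] on the ball and the
   Lipschitz bound on the inverse. *)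
have flip x y : `|x0 - x| <= r -> `|x0 - y| <= r -> `|x - y| <= 2 * `|(f x - f y) *m B|.
  move=> xr yr; have := gcontr _ _ xr yr.
  have -> : x - y = (g x - g y) + (f x - f y) *m B.
    rewrite /g mulmxBl opprB -addrA [_ - y + _]addrC.
    by rewrite [f x *m B - _ + _]addrA subrK addrA subrK.
  set a := g x - g y; set b := _ *m B => H.
  have := ler_normD a b; lra.
have finj x y : `|x0 - x| <= r -> `|x0 - y| <= r -> f x = f y -> x = y.
  move=> xr yr fxy; apply/eqP; rewrite -subr_eq0 -normr_le0.
  by apply: le_trans (flip _ _ xr yr) _; rewrite fxy subrr mul0mx normr0 mulr0.
(* The radius [r / 2] is what a Newton step can afford: [|x0 - x'| <= |x0 - x| / 2 + |(y - f x0) B|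
   < r]. *)
pose W := [set y : 'rV[R]_m | `|(y - f x0) *m B| < r / 2].
have cB z : continuous (fun y : 'rV[R]_m => `|(y - z) *m B|).
  move=> y; apply: (@continuous_comp _ _ _ (fun y => (y - z) *m B) Num.norm).
    apply: (@continuous_comp _ _ _ (fun y => y - z) (mulmxr B)).
      by apply: (@cvgB _ _ _ (nbhs y) _ id (fun=> z)); [exact: cvg_id|exact: cvg_cst].
    exact: linear_rV_continuous.
  exact: norm_continuous.
have oW : open W.
  by apply: (open_comp (f := fun y => `|(y - f x0) *m B|) (D := [set t | t < r / 2])) => [y _|];
    [exact: cB|exact: open_lt].
have cball : compact [set x | `|x0 - x| <= r].
  apply: bounded_closed_compact.
    exists (`|x0| + r); split; [exact: num_real|move=> a ar x /= xr]; apply: le_trans (ltW ar).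
    rewrite -[x](subKr x0); apply: le_trans (ler_normB _ _) _.
    by rewrite lerD2l.
  apply: (@preimage_closed _ _ (fun x => `|x0 - x|) [set t | t <= r]) => [x _|].
    apply: (@continuous_comp _ _ _ (fun x => x0 - x) Num.norm); last exact: norm_continuous.
    by apply: (@cvgB _ _ _ (nbhs x) _ (fun=> x0) id); [exact: cvg_cst|exact: cvg_id].
  exact: closed_le.
have cf x : `|x0 - x| <= r -> {for x, continuous f}.
  by move=> /Hr[Ux _ _]; exact: differentiable_continuous (df x Ux).
have /choice[h Hh] : forall y, exists x, W y -> `|x0 - x| < r /\ f x = y.
  move=> y; have [Wy|] := pselect (W y); last by exists 0.
  (* A minimiser [x] of the residual is a zero: the Newton step [x'] stays in the
     ball and halves the residual. *)
  have [||x] := @EVT_min_rV R m (fun x => `|(f x - y) *m B|) _ _ cball.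
  - by exists x0 => /=; rewrite subrr normr0 ltW.
  - apply: continuous_in_subspaceT => x; rewrite inE /= => xr.
    apply: (@continuous_comp _ _ _ f (fun z => `|(z - y) *m B|)); first exact: cf.
    exact: cB.
  rewrite inE /= => xr minx.
  pose x' := x + (y - f x) *m B.
  have x'E : x' = g x + y *m B by rewrite /x' /g mulmxBl [y *m B - _]addrC addrA.
  have x'r : `|x0 - x'| <= 2^-1 * `|x0 - x| + `|(y - f x0) *m B|.
    have -> : x0 - x' = (g x0 - g x) - (y - f x0) *m B.
      have aux (a b d e : 'rV[R]_m) : a - (d + e) = a - b - d - (e - b).
        rewrite opprB -[RHS]addrA [- d + _]addrC -[_ - d]addrA [RHS]addrA subrK.
        by rewrite -opprD [e + _]addrC.
      by rewrite x'E (aux x0 (f x0 *m B)) -mulmxBl.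
    apply: le_trans (ler_normB _ _) _; rewrite lerD2r.
    by apply: gcontr => //; rewrite subrr normr0 ltW.
  have Wy' : `|(y - f x0) *m B| < r / 2 := Wy.
  have x'r' : `|x0 - x'| < r.
    by apply: le_lt_trans x'r _; move: Wy' xr; set a := `|_ *m B|; lra.
  have := minx x'; rewrite inE => /(_ (ltW x'r')).
  have -> : (f x' - y) *m B = g x - g x'.
    rewrite [g x']/g opprB addrCA mulmxBl; congr (_ + _).
    by rewrite x'E opprD addrA subrr add0r.
  have xx' : `|x - x'| = `|(f x - y) *m B|.
    by rewrite /x' opprD addNKr -mulNmx opprB.
  have := gcontr _ _ xr (ltW x'r'); rewrite xx'.
  set a := `|_ *m B|; set b := `|g _ - _| => ba ab.
  have a0 : a = 0 by apply/eqP; rewrite eq_le normr_ge0 andbT; lra.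
  have xe : x = x' by apply/eqP; rewrite -subr_eq0 -normr_eq0 xx' -/a a0.
  exists x => _; split; first by rewrite xe.
  have : (f x - y) *m B = 0 by apply/eqP; rewrite -normr_eq0 -/a a0.
  move=> /(congr1 (mulmx^~ (jacobian f x0))); rewrite mulmxKV// mul0mx.
  by move/eqP; rewrite subr_eq0 => /eqP.
have hr y : W y -> `|x0 - h y| <= r by move=> /Hh[/ltW].
have [K K0 HK] := linear_lipschitz (@linear_rV_continuous R m 'rV[R]_m (mulmxr B)).
exists W, h; split.
- by split=> //; rewrite /W /= subrr mul0mx normr0 divr_gt0.
- by move=> y Wy; have [_ fh] := Hh y Wy; have [] := Hr _ (hr _ Wy).
- apply: (inverse_smooth oU oW sf).
  + by move=> y /hr/Hr[].
  + by move=> y /hr/Hr[].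
  + move=> y Wy; have [Uy Jy _] := Hr _ (hr _ Wy).
    have K2 : 0 < 2 * K by rewrite mulr_gt0.
    apply: (@inverse_differentiable f h W y (2 * K)) => //; first by move=> z /Hh[].
      exact: df.
    move=> z Wz; apply: le_trans (flip _ _ (hr _ Wz) (hr _ Wy)) _.
    by rewrite -mulrA ler_wpM2l// (Hh z Wz).2 (Hh y Wy).2; exact: HK.
- have n1 : \forall x \near x0, `|x0 - x| <= r.
    by apply: (norm_ball_near rpos) => x /ltW.
  have n2 : \forall x \near x0, W (f x).
    apply: (differentiable_continuous (df _ Ux0)).
    apply: open_nbhs_nbhs; split=> //.
    by rewrite /W /= subrr mul0mx normr0 divr_gt0.
  apply: (@filterS2 _ (nbhs x0) (nbhs_filter x0) _ _ _ _ n1 n2) => x xr Wx; have [hx fh] := Hh _ Wx.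
  by apply: finj => //; exact: ltW.
Qed.

End InverseFunction.
(** * From the Gauss map to the sphere *)

Lemma Ck_on_sub {R : realType} {V W : normedModType R} k (U U' : set V) (f : V -> W) :
  U' `<=` U -> Ck_on k U f -> Ck_on k U' f.
Proof.
move=> sU; elim: k f => [|k IH] f /=; first by move=> cf x /sU; exact: cf.
by move=> [df Df]; split=> [x /sU|v]; [exact: df|exact: IH].
Qed.

Lemma open_preimage_on {T U : topologicalType} (A : set T) (B : set U) (f : T -> U) :
  open A -> open B -> (forall x, A x -> {for x, continuous f}) -> open (A `&` f @^-1` B).
Proof.
move=> oA oB cf; rewrite openE => x [Ax Bfx]; rewrite /interior.
have nA : nbhs x A by exact: open_nbhs_nbhs.
have nB : nbhs x (f @^-1` B) by apply: (cf x Ax); exact: open_nbhs_nbhs.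
exact: filterI.
Qed.

Lemma derive_coord {R : realType} {V : normedModType R} {m : nat} (f : V -> 'rV[R]_m) x v j :
  differentiable f x -> 'D_v (fun x => f x 0 j) x = ('d f x v) 0 j.
Proof.
move=> df; rewrite -deriveE// derive_mx ?mxE//; exact: diff_derivable.
Qed.

Lemma derivable_coord {R : realType} {V : normedModType R} {m : nat} (f : V -> 'rV[R]_m) x v j :
  differentiable f x -> derivable (fun x => f x 0 j) x v.
Proof.
by move=> df; have /derivable_mxP/(_ 0 j) : derivable f x v by exact: diff_derivable.
Qed.

Lemma derive_mul1D {R : realType} {V : normedModType R} (a b : V -> R) x v :
  derivable a x v -> derivable b x v ->
  'D_v (fun z => (1 + a z) * b z) x = (1 + a x) * 'D_v b x + 'D_v a x * b x.
Proof.
move=> da db; have dc : derivable (cst (1 : R) : V -> R) x v := derivable_cst _ _ _.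
have -> : (fun z => (1 + a z) * b z) = (cst 1 + a) * b by [].
rewrite (deriveM (derivableD dc da) db) (deriveD dc da) derive_cst add0r.
by congr (_ + _); exact: mulrC.
Qed.

(** Differentiating the constant [dotv f f] gives [2 * dotv f ('d f v)]. It serves both for the unit
    normal and for a map into the sphere. *)
Lemma dotv_diff_eq0 {R : realType} {V : normedModType R} {m : nat} (U : set V)
    (f : V -> 'rV[R]_m) (c : R) x v :
  open U -> U x -> (forall y, U y -> dotv (f y) (f y) = c) -> differentiable f x ->
  dotv (f x) ('d f x v) = 0.
Proof.
move=> oU Ux fc df.
have fder i : derivable (fun y => f y 0 i) x v by exact: derivable_coord.
have H : 'D_v (fun y => dotv (f y) (f y)) x = 2 * dotv (f x) ('d f x v).
  have -> : (fun y => dotv (f y) (f y)) =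
      \sum_(i < m) ((fun y => f y 0 i) * (fun y => f y 0 i)).
    by apply/funext => y; rewrite fct_sumE.
  rewrite derive_sum => [|i]; last exact: derivableM.
  rewrite mulr_sumr; apply: eq_bigr => i _.
  rewrite deriveM// derive_coord// -[_ *: _]/(_ * _); ring.
have : 'D_v (fun y => dotv (f y) (f y)) x = 0.
  by rewrite (derive_eq_on v oU Ux fc) derive_cst.
by rewrite H => /eqP; rewrite mulf_eq0 pnatr_eq0 => /eqP.
Qed.

(** * Immersions of [M] into the sphere and their smooth inverses *)

Section LocalInverse.
Context {R : realType} {n : nat} {M : smoothManifold R n}.
Implicit Types (p q : M).

Lemma smooth_diff {W : normedModType R} (F : M -> W) p : smooth F ->
  differentiable (F \o cinv (chart_at p)) (chart_at p p).
Proof.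
move=> sF; have [df _] := sF _ (chart_at_atlas p) 1%N.
by apply: df; exists p => //; exact: chart_at_dom.
Qed.

Lemma smooth_continuous {W : normedModType R} (F : M -> W) : smooth F -> continuous F.
Proof.
move=> sF p; set c := chart_at p.
have Dp : cdom c p by exact: chart_at_dom.
have cc : {for p, continuous ((F \o cinv c) \o c)}.
  apply: continuous_comp; first exact: cmap_continuous.
  exact: differentiable_continuous (smooth_diff p sF).
by apply: (continuous_at_eq_on (cdom_open c) Dp) cc => q Dq; rewrite /= cmapK.
Qed.

Let rsub : {linear 'rV[R]_n.+1 -> 'rV[R]_n} :=
  mulmxr (col_mx (0 : 'rV[R]_n) 1%:M : 'M[R]_(n.+1, n)).
Let lift0 : {linear 'rV[R]_n -> 'rV[R]_n.+1} :=
  mulmxr (row_mx (0 : 'cV[R]_n) 1%:M : 'M[R]_(n, n.+1)).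

Let rsubE w : rsub w = @rsubmx R 1 1 n w.
Proof.
rewrite -[in LHS](@hsubmxK R 1 1 n w) /rsub /= (@mul_row_col R 1 1 n n).
by rewrite mulmx0 add0r mulmx1.
Qed.

Let lift0E x : lift0 x = row_mx (0 : 'rV_1) x.
Proof. by rewrite /lift0 /= (@mul_mx_row R 1 n 1 n) mulmx0 mulmx1. Qed.

Let rsub_continuous : continuous rsub. Proof. exact: linear_rV_continuous. Qed.

Let lift0_continuous : continuous lift0. Proof. exact: linear_rV_continuous. Qed.

Let rsubK x : rsub (lift0 x) = x.
Proof. by rewrite rsubE lift0E; exact: (@row_mxKr R 1 1 n). Qed.

Let lift00 x : lift0 x 0 0 = 0.
Proof.
rewrite lift0E; have -> : (0 : 'I_n.+1) = lshift n (0 : 'I_1) by apply: val_inj.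
by rewrite (@row_mxEl R 1 1 n) mxE.
Qed.

Variables (rho : R) (F : M -> 'rV[R]_n.+1).
Hypotheses (rho0 : 0 < rho) (sF : smooth F) (SF : forall p, sphere n rho (F p))
  (iF : forall p, injective (mdiff F p)).

(** One [G] serves twice: as the local section that the covering argument needs, and as the smooth
    ambient extension of the inverse in [diffeomorphism_onto]. *)
Lemma local_inverse p : exists (U : set 'rV[R]_n.+1) (G : 'rV[R]_n.+1 -> M),
  [/\ open U /\ U (F p), smooth_into U G,
    forall y, U y -> sphere n rho y -> F (G y) = y & \forall q \near p, G (F q) = q].
Proof.
set c := chart_at p; pose O := c @` cdom c; pose f := F \o cinv c.
have Dp : cdom c p by exact: chart_at_dom.
have oO : open O by exact: ccod_open.
have Op : O (c p) by exists p.
have sf : smooth_on O f by exact: sF (chart_at_atlas p).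
have fF q : cdom c q -> f (c q) = F q by move=> Dq; rewrite /f /= cmapK.
have ff y : O y -> dotv (f y) (f y) = rho ^+ 2.
  by move=> [q Dq <-]; rewrite fF// -enorm_sqr SF.
have dfp : differentiable f (c p) by exact: smooth_diff.
(* [Psi (t, x) = (1 + t) f x] extends the chart [f] of the sphere to a chart of R^n+1. *)
pose Psi (z : 'rV[R]_n.+1) : 'rV[R]_n.+1 := (1 + z 0 0) *: f (rsub z).
pose O' := [set z : 'rV[R]_n.+1 | 0 < 1 + z 0 0] `&` rsub @^-1` O.
have oO' : open O'.
  apply: openI; last by apply: open_comp => // z _; exact: rsub_continuous.
  apply: (@open_comp _ _ (fun z : 'rV[R]_n.+1 => 1 + z 0 0) [set t | 0 < t]) => [z _|].
    have ct := @coord_continuous R 1 n.+1 0 0 z.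
    exact: cvgD (cvg_cst _) ct.
  exact: open_gt.
have sPsi : smooth_on O' Psi.
  move=> k; apply: Ck_on_rV => // j.
  have -> : (fun z => Psi z 0 j) = (fun z => (1 + z 0 0) * f (rsub z) 0 j).
    by apply/funext => z; rewrite mxE.
  apply: Ck_on_mul => //.
    apply: Ck_on_add => //; first exact: Ck_on_cst.
    by apply: (Ck_on_coord oO' 0); exact: Ck_on_id.
  apply: (Ck_on_coord oO' j); apply: (Ck_on_comp oO' oO _ _ (sf k)) => [z []//|].
  by apply: (@Ck_on_linear R _ O' oO' _ _ rsub k id) => //; exact: Ck_on_id.
pose z0 := lift0 (c p).
have O'z0 : O' z0.
  split; first by rewrite -[_ z0]/(is_true (0 < 1 + z0 0 0)) lift00 addr0.
  by rewrite -[_ z0]/(O (rsub z0)) rsubK.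
have [dPsi _] := sPsi 1%N.
have dPsiE w : 'd Psi z0 w = w 0 0 *: f (c p) + 'd f (c p) (rsub w).
  apply/rowP => j; rewrite -derive_coord; last exact: dPsi.
  have dfr : differentiable (f \o rsub) z0.
    apply: differentiable_comp; first exact: linear_differentiable.
    by rewrite rsubK.
  pose a (z : 'rV[R]_n.+1) : R := z 0 0.
  have da : derivable a z0 w by exact: (@derivable_coord _ _ _ id).
  have Da : 'D_w a z0 = w 0 0 by rewrite (@derive_coord _ _ _ id)// diff_val.
  pose b (z : 'rV[R]_n.+1) : R := (f \o rsub) z 0 j.
  have db : derivable b z0 w by exact: derivable_coord.
  have Db : 'D_w b z0 = ('d f (c p) (rsub w)) 0 j.
    have Dr : 'd rsub z0 w = rsub w by rewrite diff_lin.
    have H : 'd (f \o rsub) z0 w = 'd f (rsub z0) ('d rsub z0 w).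
      rewrite diff_comp//; last by rewrite rsubK.
      exact: linear_differentiable.
    by rewrite derive_coord// H Dr rsubK.
  have -> : (fun z => Psi z 0 j) = (fun z => (1 + a z) * b z).
    by apply/funext => z; rewrite mxE.
  have b0 : b z0 = f (c p) 0 j by rewrite -[LHS]/(f (rsub z0) 0 j) rsubK.
  have a0 : a z0 = 0 by exact: lift00.
  rewrite (derive_mul1D da db) Da Db a0 b0 addr0 mul1r addrC.
  by rewrite [RHS]mxE [X in _ = X + _]mxE.
have [|W [h [[oW Wp] hW sh nh]]] := inverse_function oO' O'z0 sPsi.
  (* The radial and tangential parts of ['d Psi] are orthogonal since [f] has constant length:
     pairing with [f] kills [w 0 0], and injectivity of [mdiff F p] kills the rest. *)
  apply: raddf_inj => w dw; have {dw} : 'd Psi z0 w = 0 := dw; rewrite dPsiE => w0.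
  have w00 : w 0 0 = 0.
    have := congr1 (dotv (f (c p))) w0.
    rewrite dotvDr dotvZr (dotv_diff_eq0 _ oO Op ff dfp) addr0 ff// dotvC dotv0l => /eqP.
    by rewrite mulf_eq0 expf_eq0 /= (gt_eqF rho0) orbF => /eqP.
  have rw : rsub w = 0.
    apply: (iF (p := p)); move: w0; rewrite w00 scale0r add0r /mdiff -/c -/f => ->.
    by rewrite linear0.
  by apply/eqP; rewrite -dotv_eq0 dotv_split w00 -rsubE rw dotv0l expr0n addr0.
have Psi0 : Psi z0 = F p by rewrite /Psi lift00 addr0 scale1r rsubK fF.
rewrite Psi0 in Wp.
pose G y := cinv c (rsub (h y)).
have OG y : W y -> O (rsub (h y)) by move=> /hW[[]].
have ch y : W y -> {for y, continuous h} by move=> Wy; exact: (Ck_on_continuous (sh 0%N)).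
have cG y : W y -> {for y, continuous G}.
  move=> Wy; apply: (@continuous_comp _ _ _ (rsub \o h) (cinv c)).
    by apply: continuous_comp; [exact: ch|exact: rsub_continuous].
  by apply: cinv_continuous; exact: OG.
exists W, G; split.
- by [].
- split=> // d Md.
  have oWd : open (W `&` G @^-1` cdom d) by apply: open_preimage_on => //; exact: cdom_open.
  have cdE : c @` (cdom c `&` cdom d) = O `&` cinv c @^-1` cdom d.
    apply/seteqP; split=> y.
      by move=> [q [cq dq] <-]; split; [exists q|rewrite /= cmapK].
    by move=> [[q cq <-]]; rewrite /= cmapK// => dq; exists q.
  have ocd : open (c @` (cdom c `&` cdom d)).
    rewrite cdE; apply: open_preimage_on => //; first exact: cdom_open.
    by move=> y Oy; exact: cinv_continuous.
  move=> k; apply: (@Ck_on_comp R 'rV[R]_n.+1 n n k _ _ (rsub \o h) (d \o cinv c) oWd ocd).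
  + by move=> y [Wy dy]; rewrite cdE; split=> //; exact: OG.
  + apply: (@Ck_on_linear R _ _ oWd _ _ rsub k h) => //.
    by apply: Ck_on_sub (sh k) => y [].
  + exact: atlas_compatible (chart_at_atlas p) Md k.
- move=> y Wy Sy; have [[t0 Ory] Py] := hW y Wy.
  move: Py; rewrite /Psi -/(f _); set t := 1 + _ => Py.
  (* Comparing lengths gives [t ^+ 2 = 1]; the condition [0 < 1 + z 0 0] in [O'] excludes
     [t = -1]. *)
  have t1 : t = 1.
    have := congr1 (fun u => dotv u u) Py.
    rewrite dotvZl dotvZr ff// -[dotv y y]enorm_sqr Sy.
    move=> tt; apply/eqP; rewrite -subr_eq0.
    have : (t - 1) * ((t + 1) * rho ^+ 2) == 0 by apply/eqP; move: tt; lra.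
    have q0 : 0 < (t + 1) * rho ^+ 2 by rewrite mulr_gt0 ?exprn_gt0// ltr_wpDr.
    by rewrite mulf_eq0 (gt_eqF q0) orbF.
  by rewrite -[RHS]Py t1 scale1r.
- have cl : {for p, continuous (lift0 \o c)}.
    by apply: continuous_comp; [exact: cmap_continuous|exact: lift0_continuous].
  have n1 : \forall q \near p, h (Psi (lift0 (c q))) = lift0 (c q) by exact: cl nh.
  have n2 : \forall q \near p, cdom c q by apply: open_nbhs_nbhs; split=> //; exact: cdom_open.
  apply: filterS2 n1 n2 => q + Dq.
  rewrite {1}/Psi lift00 addr0 scale1r rsubK fF// => hq.
  by rewrite /G hq rsubK cmapK.
Qed.

(** [local_inverse] gives [G (F q) = q] only for [q] near [p], while every [q] with [F q] in the
    open set is required. The compact image of the complement of that neighbourhood is removed; it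
    misses [F p] because [F] is injective. *)
Lemma sphere_diffeomorphism : (2 <= n)%N -> compact [set: M] -> connected [set: M] ->
  [set: M] !=set0 -> diffeomorphism_onto (sphere n rho) F.
Proof.
move=> hn cM coM M0.
have hM : hausdorff_space M := @hausdorff_carrier R n M.
have cF : continuous F by exact: smooth_continuous.
have bF : set_bij [set: M] (sphere n rho) F.
  apply: sphere_covering_bijective => // p.
  have [U [G [oU sG FG nG]]] := local_inverse p; exists U, G; split=> // y Uy.
  by case: sG => cG _; exact: cG.
split=> // y Sy; have [_ iFF sFF] := bF.
have [p _ Fp] := sFF y Sy.
have [U [G [[oU Up] [cG sG] FG nG]]] := local_inverse p.
pose N := interior [set q | G (F q) = q].
have cN : closed (F @` ~` N).
  apply: compact_closed; first exact: norm_hausdorff.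
  apply: continuous_compact; first exact: continuous_subspaceT.
  by apply: (subclosed_compact _ cM) => //; apply: open_closedC; exact: open_interior.
have oUN : open (U `&` ~` (F @` ~` N)) by apply: openI => //; exact: closed_openC.
exists (U `&` ~` (F @` ~` N)), G; split => //.
- rewrite -Fp; split=> // -[q Nq Fqp].
  have qp : q = p by apply: iFF; rewrite ?inE.
  by apply: Nq; rewrite qp.
- split=> [z [Uz _]|d Md k]; first exact: cG.
  by apply: Ck_on_sub (sG d Md k) => z [[Uz _] dz].
- move=> q [_ NFq]; apply: (@interior_subset _ [set q | G (F q) = q]).
  by apply: contrapT => Nq; apply: NFq; exists q.
Qed.

End LocalInverse.

(** * Linear algebra behind the tensor norm *)

Section CauchySchwarz.
Context {R : realType}.

Lemma dotv_mul {m} (u v : 'rV[R]_m) : dotv u v = (u *m v^T) 0 0.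
Proof. by rewrite mxE; apply: eq_bigr => i _; rewrite mxE. Qed.

Lemma dotv_cauchy {m} (u v : 'rV[R]_m) : dotv u v ^+ 2 <= dotv u u * dotv v v.
Proof.
have [->|v0] := eqVneq v 0; first by rewrite dotvC !dotv0l expr0n mulr0.
have vv : 0 < dotv v v by rewrite dotv_gt0.
have := dotv_ge0 (dotv v v *: u + (- dotv u v) *: v).
rewrite dotvDl !dotvDr !dotvZl !dotvZr (dotvC v u).
set a := dotv u u; set b := dotv u v; set d := dotv v v in vv *.
have -> : d * (d * a) + d * (- b * b) + (- b * (d * b) + - b * (- b * d)) =
  d * (a * d - b ^+ 2) by ring.
by rewrite pmulr_rge0// subr_ge0.
Qed.

(** Cauchy-Schwarz against each column; the trace is the squared Frobenius norm. *)
Lemma dotv_mulmx_le {m p} (u : 'rV[R]_m) (X : 'M[R]_(m, p)) :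
  dotv (u *m X) (u *m X) <= dotv u u * \tr (X *m X^T).
Proof.
have -> : \tr (X *m X^T) = \sum_j dotv (col j X)^T (col j X)^T.
  rewrite /mxtrace; under eq_bigr do rewrite mxE.
  rewrite exchange_big; apply: eq_bigr => j _; apply: eq_bigr => i _.
  by rewrite !mxE.
rewrite mulr_sumr; apply: ler_sum => j _.
have -> : (u *m X) 0 j = dotv u (col j X)^T.
  by rewrite mxE; apply: eq_bigr => i _; rewrite !mxE.
by rewrite -expr2; exact: dotv_cauchy.
Qed.

(* With [Q = P^-1 J], where [P = J J^T] is the Gram matrix, [Q Q^T = P^-1];
   hence the squared [P]-norm of [A] is the Frobenius norm of [Q^T A Q]. *)
Lemma gram_norm_bound {n m} (J N : 'M[R]_(n, m)) (u v : 'rV[R]_n) :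
  row_free J -> u *m N = v *m J ->
  dotv (u *m N) (u *m N) <=
  \tr (invmx (J *m J^T) *m (- (N *m J^T)) *m invmx (J *m J^T) *m (- (N *m J^T))^T) *
  dotv (u *m J) (u *m J).
Proof.
move=> freeJ uN; set P := J *m J^T; set G := invmx P; set A := - (N *m J^T).
have Pu : P \in unitmx.
  rewrite -row_free_unit; apply/inj_row_free => x xP.
  have : dotv (x *m J) (x *m J) == 0.
    by rewrite dotv_mul trmx_mul mulmxA -[x *m J *m J^T]mulmxA xP mul0mx mxE.
  rewrite dotv_eq0 => /eqP xJ.
  by apply/eqP; rewrite -(mulmx_free_eq0 x freeJ) xJ.
have PT : P^T = P by rewrite /P trmx_mul trmxK.
have GT : G^T = G by rewrite /G trmx_inv PT.
have [Q [QQ JQ]] : exists Q : 'M[R]_(n, m), Q *m Q^T = G /\ J *m Q^T = 1%:M.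
  exists (G *m J); rewrite trmx_mul GT !mulmxA mulmxV//.
  by rewrite -[G *m J *m J^T]mulmxA mulVmx// mul1mx.
have QJ : Q *m J^T = 1%:M by rewrite -[LHS]trmxK trmx_mul trmxK JQ trmx1.
pose X := Q^T *m A *m Q.
have trX : \tr (G *m A *m G *m A^T) = \tr (X *m X^T).
  have -> : X *m X^T = Q^T *m (A *m G *m A^T *m Q).
    by rewrite /X !trmx_mul trmxK !mulmxA -(mulmxA (Q^T *m A) Q) QQ.
  by rewrite [RHS]mxtrace_mulC -[_ *m Q *m _]mulmxA QQ [RHS]mxtrace_mulC !mulmxA.
(* [u *m N = v *m J] lies in the row space of [J], where pairing with [J] determines it.
   Cauchy-Schwarz then bounds the square of [w = dotv (u *m N) (u *m N)] by a multiple of [w], and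
   one factor cancels unless it is 0. *)
have wE : dotv (u *m N) (u *m N) = - dotv ((u *m J) *m X) (u *m N).
  have E1 : u *m N *m (u *m N)^T = - (u *m A *m v^T).
    by rewrite [in X in _ *m X]uN trmx_mul /A mulmxN mulNmx opprK !mulmxA.
  have E2 : u *m J *m X *m (u *m N)^T = u *m A *m v^T.
    rewrite uN trmx_mul /X !mulmxA -(mulmxA u J) JQ mulmx1.
    by rewrite -(mulmxA (u *m A) Q) QJ mulmx1.
  by rewrite !dotv_mul E1 E2 mxE.
have := dotv_cauchy ((u *m J) *m X) (u *m N).
have := dotv_mulmx_le (u *m J) X; rewrite -trX.
have -> : dotv (u *m J *m X) (u *m N) = - dotv (u *m N) (u *m N) by rewrite wE opprK.
rewrite sqrrN expr2; set w := dotv (u *m N) _; set a := dotv _ _; set b := \tr _; set d := dotv _ _.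
have : 0 <= w by exact: dotv_ge0.
rewrite le_eqVlt => /orP[/eqP<-|w0] dab ww.
  by rewrite mulrC; apply: le_trans dab; exact: dotv_ge0.
by rewrite mulrC; apply: le_trans dab; rewrite -(ler_pM2r w0).
Qed.

End CauchySchwarz.

(** * The deviation of an almost-umbilical hypersurface from a sphere *)

Section AlmostUmbilical.
Context {R : realType} {n : nat} {M : smoothManifold R n}.
Variables (g : riemannianMetric M) (phi nu : M -> 'rV[R]_n.+1) (k eps : R).
Hypotheses (iso : isometric_immersion g phi) (un : unit_normal phi nu)
  (heps : 0 < eps).
Hypothesis umbilical : (sup_norm g (fun p u v =>
  (second_fundamental_form phi nu p u v - k * g p u v)%R) <= eps%:E)%E.

(** This is [k] times the differential of the centre map [phi + nu / k], which is constant on a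
    round sphere with [B = k g]. *)
Let deviation (p : M) (u : tangent p) := mdiff nu p u + k *: mdiff phi p u.

(** The deviation is tangent: [d nu] is orthogonal to [nu] because [nu] has unit length, and [d phi]
    is by definition of a normal. Its pairings with [d phi] are the components of [-(B - k g)], so
    [gram_norm_bound] applies. *)
Lemma deviation_bound p (u : tangent p) :
  dotv (deviation u) (deviation u) <= eps ^+ 2 * g p u u.
Proof.
have [sphi iphi gphi] := iso; have [snu nu1 nuphi] := un.
set c := chart_at p; have Dp : cdom c p by exact: chart_at_dom.
have jac (f : M -> 'rV[R]_n.+1) : exists B : 'M[R]_(n, n.+1), forall v, mdiff f p v = v *m B.
  by exists (jacobian (f \o cinv c) (c p)) => v; rewrite /mdiff mul_rV_lin1.
have [J phiE] := jac phi; have [B nuE] := jac nu.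
have [N NE] : exists N, N = B + k *: J by eexists.
have devE v : @deviation p v = v *m N.
  by rewrite /deviation phiE nuE NE mulmxDr scalemxAr.
have freeJ : row_free J.
  apply/inj_row_free => v vJ; apply: (iphi p); rewrite !phiE vJ mul0mx//.
have nu_dnu v : dotv (nu p) (mdiff nu p v) = 0.
  have dnu : differentiable (nu \o cinv c) (c p) by exact: smooth_diff.
  have Op : (c @` cdom c) (c p) by exists p.
  have nuc : forall y, (c @` cdom c) y -> dotv ((nu \o cinv c) y) ((nu \o cinv c) y) = 1.
    by move=> y _; rewrite -enorm_sqr nu1 expr1n.
  have := dotv_diff_eq0 v (@ccod_open R n M c) Op nuc dnu.
  by rewrite /= cmapK.
have nudev v : dotv (nu p) (v *m N) = 0.
  have nJ : dotv (nu p) (v *m J) = 0 by rewrite -phiE nuphi.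
  have nB : dotv (nu p) (v *m B) = 0 by rewrite -nuE nu_dnu.
  by rewrite NE mulmxDr -scalemxAr dotvDr dotvZr nB nJ mulr0 addr0.
have [v uN] : exists v : 'rV[R]_n, u *m N = v *m J.
  (* The normal and the rows of [J] form a basis of R^(n+1); the coefficient of [u *m N] along the
     normal is 0, which leaves the row space of [J]. *)
  pose K : 'M[R]_n.+1 := @col_mx R 1 n n.+1 (nu p) J.
  have KE (z : 'rV[R]_n.+1) : z *m K = z 0 0 *: nu p + @rsubmx R 1 1 n z *m J.
    rewrite -[in LHS](@hsubmxK R 1 1 n z) (@mul_row_col R 1 1 n n.+1); congr (_ + _).
    apply/rowP => j; rewrite !mxE big_ord1 !mxE; congr (z _ _ * _).
    exact: val_inj.
  have nuJ x : dotv (nu p) (x *m J) = 0 by rewrite -phiE nuphi.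
  have nunu : dotv (nu p) (nu p) = 1 by rewrite -enorm_sqr nu1 expr1n.
  have Ku : K \in unitmx.
    rewrite -row_free_unit; apply/inj_row_free => z; rewrite KE => zK.
    have z0 : z 0 0 = 0.
      have := congr1 (dotv (nu p)) zK.
      by rewrite dotvDr dotvZr nuJ nunu mulr1 addr0 dotvC dotv0l.
    move: zK; rewrite z0 scale0r add0r => /eqP; rewrite mulmx_free_eq0// => /eqP rz.
    by apply/eqP; rewrite -dotv_eq0 dotv_split z0 rz dotv0l expr0n addr0.
  pose z : 'rV[R]_n.+1 := u *m N *m invmx K.
  have zK : u *m N = z 0 0 *: nu p + @rsubmx R 1 1 n z *m J by rewrite -KE /z mulmxKV.
  exists (@rsubmx R 1 1 n z).
  have z0 : z 0 0 = 0.
    have := congr1 (dotv (nu p)) zK.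
    by rewrite nudev dotvDr dotvZr nuJ nunu mulr1 addr0.
  by rewrite zK z0 scale0r add0r.
rewrite devE; apply: le_trans (gram_norm_bound freeJ uN) _.
have -> : g p u u = dotv (u *m J) (u *m J) by rewrite -gphi phiE.
rewrite ler_wpM2r ?dotv_ge0//.
pose T : tensor2 M := fun p u v => second_fundamental_form phi nu p u v - k * g p u v.
have TE : tensor_norm g T p = Num.sqrt (\tr (invmx (J *m J^T) *m (- (N *m J^T)) *m
    invmx (J *m J^T) *m (- (N *m J^T))^T)).
  have entry (E : 'M[R]_n) i j : E i j = ((delta_mx 0 i : 'rV[R]_n) *m E *m (delta_mx 0 j : 'rV[R]_n)^T) 0 0.
    by rewrite -rowE trmx_delta -colE !mxE.
  have -> : J *m J^T = components (metric g) p.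
    apply/matrixP => i j; rewrite [RHS]mxE -gphi !phiE dotv_mul trmx_mul mulmxA.
    by rewrite -[_ *m J *m J^T]mulmxA -entry.
  have -> // : - (N *m J^T) = components T p.
  apply/matrixP => i j; rewrite [RHS]mxE /T /second_fundamental_form -gphi.
  have -> : - dotv (mdiff nu p (delta_mx 0 i)) (mdiff phi p (delta_mx 0 j)) -
      k * dotv (mdiff phi p (delta_mx 0 i)) (mdiff phi p (delta_mx 0 j)) =
      - dotv (@deviation p (delta_mx 0 i)) (mdiff phi p (delta_mx 0 j)).
    by rewrite dotvDl dotvZl opprD.
  rewrite devE phiE dotv_mul trmx_mul mulmxA -[_ *m N *m J^T]mulmxA -entry.
  by rewrite [LHS]mxE.
have Teps : tensor_norm g T p <= eps.
  rewrite -lee_fin; apply: le_trans umbilical; apply: ereal_sup_ubound.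
  by exists p.
set t := \tr _ in TE *.
(* The square root in [tensor_norm] gives no information on a negative trace, but the bound is then
   trivial. *)
have [t0|t0] := leP 0 t; last by apply: le_trans (ltW t0) _; rewrite sqr_ge0.
rewrite -[t](sqr_sqrtr t0) -TE ler_sqr ?nnegrE ?(ltW heps)//.
by rewrite TE sqrtr_ge0.
Qed.

End AlmostUmbilical.

Theorem theorem2 (R : realType) (n : nat) (hn : (2 <= n)%N)
    (k : R) (hk : 0 < k) (theta : R) (htheta : 0 < theta < 1) :
  exists2 eps : R, 0 < eps &
    forall (M : smoothManifold R n) (g : riemannianMetric M)
           (phi nu : M -> 'rV[R]_n.+1),
      compact [set: M] -> connected [set: M] -> [set: M] !=set0 ->
      oriented M ->
      isometric_immersion g phi ->
      unit_normal phi nu ->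
      (sup_norm g (fun p u v =>
         (second_fundamental_form phi nu p u v - k * g p u v)%R)
       <= eps%:E)%E ->
      diffeomorphic_to M (sphere n k^-1) /\
      quasi_isometric_to g theta (sphere n k^-1).
Proof.
have /andP[t0 t1] := htheta.
have e0 : 0 < k * theta / 3 by rewrite divr_gt0// mulr_gt0.
exists (k * theta / 3) => // M g phi nu cM coM M0 _ iso un umb.
have [sphi iphi gphi] := iso; have [snu nu1 nuphi] := un.
pose F (p : M) := k^-1 *: nu p.
pose w (p : M) (u : tangent p) := mdiff nu p u + k *: mdiff phi p u.
have wb p (u : tangent p) : dotv (w p u) (w p u) <= (k * theta / 3) ^+ 2 * g p u u.
  exact: (deviation_bound iso un e0 umb).
have sF : smooth F.
  move=> c Mc j; apply: (@Ck_on_linear _ _ _ (@ccod_open R n M c) _ _ ( *:%R k^-1) j (nu \o cinv c)).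
    exact: scaler_continuous.
  exact: snu.
have dF p (u : tangent p) : mdiff F p u = k^-1 *: w p u - mdiff phi p u.
  have -> : mdiff F p u = k^-1 *: mdiff nu p u.
    exact: (congr1 (fun h => h u) (diffZ k^-1 (smooth_diff p snu))).
  by rewrite /w scalerDr scalerA mulVf ?gt_eqF// scale1r addrK.
have ki : 0 < k^-1 by rewrite invr_gt0.
have SF p : sphere n k^-1 (F p).
  rewrite /sphere /= /enorm dotvZl dotvZr -enorm_sqr nu1 expr1n mulr1 -expr2.
  by rewrite sqrtr_sqr ger0_norm// ltW.
(* If [mdiff F p u = 0] then [w p u = k *: mdiff phi p u] has length [k |u|], above the allowed
   [(k theta / 3) |u|] unless [u = 0]. *)
have iF p : injective (mdiff F p).
  have lin0 : mdiff F p =1 'd (F \o cinv (chart_at p)) (chart_at p p) by [].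
  apply: raddf_inj => u du; have {du} : mdiff F p u = 0 := du.
  rewrite dF => /eqP; rewrite subr_eq0 => /eqP wu.
  apply/eqP; apply: contraT => u0.
  have gu := metric_pos g u0; have := wb p u.
  have -> : w p u = k *: mdiff phi p u by rewrite -wu scalerA mulfV ?gt_eqF// scale1r.
  rewrite dotvZl dotvZr gphi mulrA ler_pM2r// leNgt => /negP; case.
  have -> : (k * theta / 3) ^+ 2 = (k * k) * (theta * theta / 9) by field.
  by rewrite gtr_pMr ?mulr_gt0//; nra.
have dif := sphere_diffeomorphism ki sF SF iF hn cM coM M0.
split; exists F => //; split=> // p u gu.
rewrite enorm_sqr dF.
have Wb := wb p u; rewrite gu mulr1 in Wb.
have CS := dotv_cauchy (w p u) (mdiff phi p u).
rewrite gphi gu mulr1 in CS.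
(* The quantity to bound is [q - 2 * s], where Cauchy-Schwarz gives [s ^+ 2 <= q] and the deviation
   bound gives [q <= theta ^+ 2 / 9]. *)
set s := k^-1 * dotv (w p u) (mdiff phi p u); set q := k^-1 ^+ 2 * dotv (w p u) (w p u).
have sq : s ^+ 2 <= q by rewrite /s exprMn ler_wpM2l// sqr_ge0.
have q0 : 0 <= q by rewrite mulr_ge0 ?sqr_ge0// dotv_ge0.
have qt : q <= theta ^+ 2 / 9.
  apply: le_trans (ler_wpM2l (sqr_ge0 k^-1) Wb) _.
  by rewrite le_eqVlt; apply/orP; left; apply/eqP; field; rewrite gt_eqF.
have -> : dotv (k^-1 *: w p u - mdiff phi p u) (k^-1 *: w p u - mdiff phi p u) = q - 2 * s + 1.
  rewrite -scaleN1r dotvDl !dotvDr !dotvZl !dotvZr gphi gu (dotvC (mdiff phi p u)) /q /s.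
  by ring.
rewrite addrK ler_norml.
have s1 : s <= theta / 3 by nra.
have s2 : - (theta / 3) <= s by nra.
by apply/andP; split; nra.
Qed.
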